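(* Let $i,n,m$ be integers with $n\ge i\ge 2$ and $n>m\ge 0$. For the Galton-Watson process with immigration $\{N_n\}_{n\ge 0}$ with offspring probability generating function $f$ and immigration probability generating function $g$, where $f(0)=g(0)=0$, the coalescence time $X_{i,1}^n$ satisfies $$P(X_{i,1}^n=\infty)=1-\sum_{l=1}^{n}\frac{1}{\Gamma(i)}\int_0^1(1-z)^{i-1}f_{l}^{(i)}(z)\,g'(f_{l}(z))\prod_{\substack{s=1\\ s\neq l}}^{n}g(f_{s}(z))\,dz,$$ and $$P(m\le X_{i,1}^n<\infty)=\frac{1}{\Gamma(i)}\int_0^1(1-z)^{i-1}f_{n-m}^{(i)}(z)\,\varphi_{\overline m}'(f_{n-m}(z))\prod_{l=1}^{n-m}g(f_{l}(z))\,dz+\sum_{k=1}^{n-m}\frac{1}{\Gamma(i)}\int_0^1(1-z)^{i-1}f_{k}^{(i)}(z)\,g'(f_{k}(z))\prod_{\substack{l=1\\ l\neq k}}^{n}g(f_{l}(z))\,dz.$$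
   Context: Model. Let $M$ and $I$ be $\mathbb Z^+=\{0,1,2,\dots\}$-valued random variables with probability generating functions $f(z)=E(z^M)$ and $g(z)=E(z^I)$, $z\in[0,1]$. Let $I_n$ ($n\ge0$) be copies of $I$ and $\xi_{n,j}$ ($n\ge0$, $j\ge1$) be copies of $M$, all these variables being mutually independent. Set $N_0=0$ and $N_{n+1}=\sum_{j=1}^{N_n+I_n}\xi_{n,j}$ for $n\ge 0$ (empty sums are $0$). Interpretation: at generation $k$ there are $N_k$ individuals born in the system, and $I_k$ immigrants join them at generation $k$; each of these $N_k+I_k$ individuals independently produces children according to the law of $M$, and the children form the $N_{k+1}$ individuals born in generation $k+1$. It is assumed throughout that $f(0)=g(0)=0$, so that $N_n\ge n$ for $n\ge1$. Let $\mathbb T$ denote the random family tree (genealogy) generated by this process. Coalescence time. For $2\le i\le n$, given $\mathbb T$, pick $i$ individuals uniformly at random without replacement from the $N_n$ individuals born in the $n$-th generation (the immigrants $I_n$ are not included) and trace their lines of descent back in time. $X_{i,1}^n$ is the index of the generation at which, going backward from generation $n$, these $i$ lines first coalesce into one individual, i.e. the generation of their most recent common ancestor (an immigrant arriving at generation $k$ is regarded as living in generation $k$). If the $i$ individuals have no common ancestor, $X_{i,1}^n=\infty$. Notation. $\varphi_{\overline n}(z)=E(z^{N_n})$ for $z\in[0,1]$, $n\ge0$. $f_n$ is the $n$-fold composition of $f$: $f_0(z)=z$, $f_n(z)=f(f_{n-1}(z))$ for $n\ge 1$. For a function $h$, $h^{(j)}$ denotes its $j$-th derivative; so $f_l^{(i)}$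 is the $i$-th derivative of $f_l$. $\Gamma$ is the Gamma function. *)

(* Defs.v *)
From mathcomp Require Import all_boot all_order all_algebra finmap.
From mathcomp Require Import all_classical all_reals all_analysis.
Import Order.TTheory GRing.Theory Num.Theory numFieldNormedType.Exports.

Set Implicit Arguments.
Unset Strict Implicit.
Unset Printing Implicit Defensive.

Local Open Scope classical_set_scope.
Local Open Scope ring_scope.

(* The genealogy for one realization: [imm k] immigrants arrive at generation
   [k], and [off k j] is the number of children of individual [j] of generation
   [k] (individuals are numbered from 0).  The individuals living in generation
   [k] are [0, ..., pop k - 1]; the first [born k] of them are born in the
   system and the remaining [imm k] are the immigrants of that generation. *)
Section Genealogy.
Variables (imm : nat -> nat) (off : nat -> nat -> nat).

Fixpoint born (n : nat) : nat :=
  if n is n'.+1 then (\sum_(0 <= j < born n' + imm n') off n' j)%N else 0%N.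

Definition pop (k : nat) : nat := (born k + imm k)%N.

Definition litters (k : nat) : seq nat := mkseq (off k) (pop k).

(* The individuals born in generation [k.+1] are numbered litter by litter, in
   the order of their parents, so the parent of [c] is the index of the litter
   containing the [c]-th child.  Immigrants have no parent. *)
Definition parent (k c : nat) : option nat :=
  if (c < born k.+1)%N then Some (reshape_index (litters k) c) else None.

(* The ancestor, [b] generations back, of individual [c] of generation [n]. *)
Fixpoint ancestor (n b c : nat) : option nat :=
  match b, n with
  | 0, _ => Some c
  | b'.+1, n'.+1 => obind (ancestor n' b') (parent n' c)
  | _.+1, 0 => None
  end.

(* The members of [s], of generation [n], have a common ancestor living in
   generation [k <= n]. *)
Definition coalesced (n : nat) (s : seq nat) (k : nat) : bool :=
  [exists a : 'I_(pop k),
     all (fun c => ancestor n (n - k) c == Some (val a)) s].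

Definition coalescence_time (R : realType) (n : nat) (s : seq nat) : \bar R :=
  if [exists k : 'I_n.+1, coalesced n s k]
  then ((\max_(k < n.+1 | coalesced n s k) k)%N%:R)%:E
  else +oo%E.

End Genealogy.

Section Probability.
Context {d : measure_display} {Omega : measurableType d} {R : realType}.
Variable P : probability Omega R.

(* Meaningful for [0 <= z <= 1], where the expectation is finite; [0 ^+ 0 = 1],
   so the value at 0 is P(X = 0).  Two-sided derivatives of [pgf] are the usual
   ones on the open interval ]0, 1[; at the endpoints they may be default values,
   which integrals over [0, 1] do not see. *)
Definition pgf (X : Omega -> nat) (z : R) : R :=
  fine ('E_P[fun w => (z ^+ X w)%R])%E.

Definition mutually_independent {d'} {T : measurableType d'} {K : choiceType}
    (X : K -> {RV P >-> T}) : Prop :=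
  forall (J : {fset K}) (B : K -> set T),
    (forall k, measurable (B k)) ->
    P (\bigcap_(k in [set` J]) X k @^-1` B k) =
    (\prod_(k <- J) P (X k @^-1` B k))%E.

Definition gwi_family (imm : nat -> {RV P >-> nat})
    (xi : nat -> nat -> {RV P >-> nat}) (k : nat + nat * nat) :
    {RV P >-> nat} :=
  match k with inl n => imm n | inr p => xi p.1 p.2 end.

Definition Nproc (imm : nat -> {RV P >-> nat})
    (xi : nat -> nat -> {RV P >-> nat}) (n : nat) (w : Omega) : nat :=
  born (fun k => imm k w) (fun k j => xi k j w) n.

(* The sigma-algebra of the family tree: it sees the offspring numbers of the
   individuals that actually live, hence also the sizes of all generations and
   the numbers of immigrants. *)
Definition tree_events (imm : nat -> {RV P >-> nat})
    (xi : nat -> nat -> {RV P >-> nat}) : set (set Omega) :=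
  <<s [set A | exists (k : nat) (t : seq nat),
        A = [set w | litters (fun k => imm k w) (fun k j => xi k j w) k = t]] >>.

(* Given the tree, [S] is a uniformly distributed sequence of [i] successive
   draws without replacement from the individuals born in generation [n]: each
   injective sequence has conditional probability 1 / (N_n)_i, where (N)_i is
   the falling factorial. *)
Definition uniform_sample (imm : nat -> {RV P >-> nat})
    (xi : nat -> nat -> {RV P >-> nat}) (n i : nat)
    (S : Omega -> i.-tuple nat) : Prop :=
  (forall s, measurable (S @^-1` [set s])) /\
  (forall (A : set Omega) (s : i.-tuple nat), tree_events imm xi A ->
     P (A `&` S @^-1` [set s]) =
     \int[P]_(w in A)
       (if uniq s && all (fun c => c < Nproc imm xi n w)%N s
        then ((Nproc imm xi n w ^_ i)%N%:R)^-1 else 0)%R%:E)%E.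

Definition coalescence (imm : nat -> {RV P >-> nat})
    (xi : nat -> nat -> {RV P >-> nat}) (n i : nat)
    (S : Omega -> i.-tuple nat) (w : Omega) : \bar R :=
  coalescence_time (fun k => imm k w) (fun k j => xi k j w) R n (S w).

End Probability.

Definition Gamma {R : realType} (x : R) : R :=
  Rintegral lebesgue_measure `]0, +oo[ (fun t => t `^ (x - 1) * expR (- t)).

(* Main.v *)
Require Import Defs.
From mathcomp Require Import all_boot all_order all_algebra finmap.
From mathcomp Require Import all_classical all_reals all_analysis.
From mathcomp Require Import measurable_realfun.
From mathcomp Require Import ring zify.
Import Order.TTheory GRing.Theory Num.Theory numFieldNormedType.Exports.

(** Trace the line of each sampled individual back until it reaches generation
    [m] or an immigrant, whichever comes first, and call the individual reached
    its founder ([founder]).  The sample has a common ancestor at a generation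
    [>= m] if and only if all its members have the same founder.  The families
    of distinct founders are disjoint, so, given the tree, this happens with
    probability [sum (Z)_i / (N_n)_i], where [Z] runs through the numbers of
    descendants of the founders and [(N)_i] is the falling factorial
    ([card_coalesced_tuples], [probability_coalesced]).  The founders are the
    individuals born in generation [m] and the immigrants of the generations
    [m, ..., n - 1]; they yield the first term and the sum of the statement.

    The Beta integral [1 / (N)_i = 1 / Gamma(i) int (1 - z)^(i-1) z^(N-i) dz]
    ([ffactV_beta]) and Fubini reduce the expectation of such a sum to that of
    [sum (Z)_i z^(N_n-i)], which is the [i]-th derivative at [x = z] of
    [E sum x^Z z^(N_n-Z)].  This generating function follows from a recursion
    on the generations ([lineage_gf]): give weight [x] to the descendants of a
    founder and [y] to all others; averaging over the offspring of a generation
    replaces [x, y] by [f x, f y] ([offspring_step]), and averaging over its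
    immigrants, none of whom descends from an earlier founder, yields a factor
    [g y] ([immigration_step]).  After [l] generations the result is
    [f_l(x) c(f_l(y)) prod_(s < l) g(f_s(y))], where [x c(y)] is the value in the
    generation of the founders: [c(y)] is [phi_m'(y) g(y)] for those born in
    generation [m] and [g'(y) phi_k(y)] for the immigrants of generation [k],
    with [phi_k = prod_(s <= k) g(f_s)] ([pgf_Nproc]).  As a function of [x] it
    is a multiple of [f_l], so that its derivative is that of the statement
    ([lineage_derivative]).  Finally [X = oo] is the complement of the case
    [m = 0], in which the first term vanishes because [phi_0] is constant.

    The first [n] litters form a random element with countably many values
    ([history]).  Measurability, the exchange of integrals and equalities of
    expectations are therefore checked on its fibers.  On a fiber the finitely
    many variables that determine the history are known, and the independence
    of the variables not yet seen applies ([history_cylinder]). *)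

Set Implicit Arguments.
Unset Strict Implicit.
Unset Printing Implicit Defensive.

Local Open Scope classical_set_scope.
Local Open Scope ring_scope.

(** * Power series with nonnegative coefficients *)

Lemma sum_nneg_series_bound (R : realType) (c : nat -> R) (h : R) N :
  (forall k, 0 <= c k) -> (\sum_(0 <= k <oo) (c k)%:E = h%:E)%E ->
  \sum_(0 <= k < N) c k <= h.
Proof.
move=> c0 ch; rewrite -lee_fin -ch -sumEFin.
by apply: nneseries_lim_ge => k _; rewrite lee_fin.
Qed.

Lemma nneseries_EFin_cvg (R : realType) (c : nat -> R) (h : R) :
  (forall k, 0 <= c k) -> (\sum_(0 <= k <oo) (c k)%:E = h%:E)%E ->
  series c @ \oo --> h.
Proof.
move=> c0 ch.
have cv : cvgn (series c).
  apply: nondecreasing_is_cvgn.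
    by apply: nondecreasing_series => k _ _; exact: c0.
  by exists h => _ [N _ <-]; exact: sum_nneg_series_bound.
suff <- : limn (series c) = h by [].
apply: EFin_inj; rewrite -ch -EFin_lim//; apply/congr_lim/funext => N /=.
by rewrite sumEFin.
Qed.

Lemma nneseries_EFin_lim (R : realType) (c : nat -> R) (h : R) :
  (forall k, 0 <= c k) -> series c @ \oo --> h ->
  (\sum_(0 <= k <oo) (c k)%:E = h%:E)%E.
Proof.
move=> c0 ch.
transitivity ((limn (series c))%:E); last by rewrite (cvg_lim _ ch).
rewrite -EFin_lim; last by apply/cvg_ex; exists h.
by apply/congr_lim/funext => N /=; rewrite sumEFin.
Qed.

Lemma convex_powerB (R : realType) (x y : R) k : 0 <= x -> x <= y ->
  k.+1%:R * x ^+ k * (y - x) <= y ^+ k.+1 - x ^+ k.+1.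
Proof.
move=> x0 xy; rewrite subrXX mulrC ler_wpM2l ?subr_ge0//.
rewrite mulr_natl -[X in _ *+ X]card_ord -sumr_const; apply: ler_sum => j _.
have jk : (j <= k)%N by rewrite -ltnS.
rewrite -[X in x ^+ X](subnK jk) exprD.
by rewrite ler_wpM2r ?exprn_ge0// lerXn2r// nnegrE (le_trans x0).
Qed.

(** The lemma [pseries_snd_diffs] asks that the series and its first two
    derived series converge.  For nonnegative coefficients this is a matter of
    convexity: for [z < y] the [k]-th derived term at [z], times [y - z], is at
    most the increment of the [k+1]-st term from [z] to [y], so the partial sums
    of the derived series are bounded by the value at [y] over [y - z]. *)
Lemma nneg_pseries_deriv (R : realType) (c : nat -> R) (h : R -> R) :
  (forall k, 0 <= c k) ->
  {in `]0, 1[, forall z, (\sum_(0 <= k <oo) (c k * z ^+ k)%:E = (h z)%:E)%E} ->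
  {in `]0, 1[, forall z, derivable h z 1 /\
    (\sum_(0 <= k <oo) (pseries_diffs c k * z ^+ k)%:E = (derive1 h z)%:E)%E}.
Proof.
have cvd (c' : nat -> R) : (forall k, 0 <= c' k) ->
    {in `]0, 1[, forall z, cvgn (pseries c' z)} ->
    {in `]0, 1[, forall z, cvgn (pseries (pseries_diffs c') z)}.
  move=> c0 cv z; rewrite in_itv/= => /andP[z0 z1].
  (* any point strictly between [z] and 1 would do *)
  pose y := (z + 1) / 2.
  have zy : z < y by rewrite /y midf_lt.
  have y1 : y < 1 by rewrite /y midf_lt.
  have y01 : y \in `]0, 1[ by rewrite in_itv/= y1 (lt_trans z0).
  have t0 (w : R) k : 0 <= w -> 0 <= c' k * w ^+ k.
    by move=> w0; rewrite mulr_ge0// exprn_ge0.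
  apply: nondecreasing_is_cvgn.
    apply: nondecreasing_series => k _ _.
    by rewrite !mulr_ge0// exprn_ge0// ltW.
  exists (limn (pseries c' y) / (y - z)) => _ [N _ <-] /=.
  rewrite ler_pdivlMr ?subr_gt0// /series/= mulr_suml.
  apply: (@le_trans _ _ (\sum_(0 <= k < N) c' k.+1 * y ^+ k.+1)).
    apply: ler_sum => k _; rewrite /pseries_diffs.
    rewrite (_ : k.+1%:R * c' k.+1 * z ^+ k * (y - z)
      = c' k.+1 * (k.+1%:R * z ^+ k * (y - z))); last first.
      by rewrite -!mulrA mulrCA.
    rewrite ler_wpM2l//; apply: (le_trans (convex_powerB k (ltW z0) (ltW zy))).
    by rewrite lerBlDr lerDl exprn_ge0// ltW.
  apply: (@le_trans _ _ (pseries c' y N.+1)).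
    by rewrite /pseries/series/= big_nat_recl//= lerDr t0// ltW// (lt_trans z0).
  apply: nondecreasing_cvgn_le; last exact: cv.
  by apply: nondecreasing_series => k _ _; rewrite t0// ltW// (lt_trans z0).
move=> c0 ch z /[dup] z01; rewrite in_itv/= => /andP[z0 z1].
have t0 (w : R) k : w \in `]0, 1[ -> 0 <= c k * w ^+ k.
  by rewrite in_itv/= => /andP[w0 _]; rewrite mulr_ge0// exprn_ge0// ltW.
have hE w : w \in `]0, 1[ -> pseries c w @ \oo --> h w.
  by move=> w01; apply: nneseries_EFin_cvg; [move=> k; exact: t0|exact: ch].
have cv0 : {in `]0, 1[, forall z, cvgn (pseries c z)}.
  by move=> w w01; apply/cvg_ex; exists (h w); exact: hE.
have d0 (c' : nat -> R) : (forall k, 0 <= c' k) ->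
    forall k, 0 <= pseries_diffs c' k by move=> ? k; rewrite mulr_ge0.
have cv1 := cvd _ c0 cv0.
have cv2 := cvd _ (d0 _ c0) cv1.
pose y := (z + 1) / 2.
have zy : z < y by rewrite /y midf_lt.
have y1 : y < 1 by rewrite /y midf_lt.
have y01 : y \in `]0, 1[ by rewrite in_itv/= y1 (lt_trans z0).
have zLy : `|z| < `|y|.
  by rewrite !gtr0_norm// (lt_trans z0).
have dh := pseries_snd_diffs (cv0 _ y01) (cv1 _ y01) (cv2 _ y01) zLy.
have nE : \forall w \near z, limn (pseries c w) = h w.
  near=> w; apply/cvg_lim => //; apply: hE.
  by near: w; exact: near_in_itvoo.
have dhz : is_derive z 1 h (limn (pseries (pseries_diffs c) z)).
  exact: near_eq_is_derive dh.
split; first by case: dhz.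
rewrite derive1E derive_val.
apply: nneseries_EFin_lim; last exact: cv1.
by move=> k; rewrite mulr_ge0 ?d0// exprn_ge0// ltW.
Unshelve. all: by end_near.
Qed.

Lemma iter_pseries_diffs (R : realType) (c : nat -> R) i k :
  iter i (@pseries_diffs R) c k = ((k + i) ^_ i)%:R * c (k + i)%N.
Proof.
elim: i k => [|i ih] k /=; first by rewrite addn0 ffactn0 mul1r.
rewrite /pseries_diffs ih mulrA -natrM addSnnS; congr (_%:R * _).
by rewrite ffactnSr addnS subSn ?leq_addl// addnK mulnC.
Qed.

Lemma nneg_pseries_derive1n (R : realType) (c : nat -> R) (h : R -> R) i :
  (forall k, 0 <= c k) ->
  {in `]0, 1[, forall z, (\sum_(0 <= k <oo) (c k * z ^+ k)%:E = (h z)%:E)%E} ->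
  {in `]0, 1[, forall z,
    (\sum_(0 <= k <oo) ((k ^_ i)%:R * c k * z ^+ (k - i))%:E
       = (derive1n i h z)%:E)%E}.
Proof.
move=> c0 ch z z01; have /andP[z0 _] : 0 < z < 1 by rewrite in_itv/= in z01.
have d0 j k : 0 <= iter j (@pseries_diffs R) c k.
  by rewrite iter_pseries_diffs mulr_ge0.
have dE j : {in `]0, 1[, forall z, (\sum_(0 <= k <oo)
    (iter j (@pseries_diffs R) c k * z ^+ k)%:E = (derive1n j h z)%:E)%E}.
  elim: j => [|j ih] w w01; first exact: ch.
  by have [_] := nneg_pseries_deriv (d0 j) ih w01; rewrite derive1nS.
have t0 k : (0 <= ((k ^_ i)%:R * c k * z ^+ (k - i))%:E)%E.
  by rewrite lee_fin !mulr_ge0// exprn_ge0// ltW.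
rewrite (nneseries_split 0 i)//= add0n [X in (X + _)%E]big1_seq ?add0e; last first.
  by move=> k /=; rewrite mem_index_iota => /andP[_ ki]; rewrite ffact_small// !mul0r.
rewrite -(dE i z z01) -[in LHS](add0n i) -nneseries_addn//.
by apply: eq_eseriesr => k _; rewrite iter_pseries_diffs addnK.
Qed.

(** Dividing by [C] shows that [h] is a power series itself; if [C = 0] all
    coefficients vanish and [h] can be any function. *)
Lemma nneg_pseries_derive1n_scaled (R : realType) (c : nat -> R) (h : R -> R) (C : R) i :
  0 <= C -> (forall k, 0 <= c k) ->
  {in `]0, 1[, forall z, (\sum_(0 <= k <oo) (c k * z ^+ k)%:E = (h z * C)%:E)%E} ->
  {in `]0, 1[, forall z,
    (\sum_(0 <= k <oo) ((k ^_ i)%:R * c k * z ^+ (k - i))%:E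
       = (derive1n i h z * C)%:E)%E}.
Proof.
rewrite le_eqVlt => /predU1P[<-|C0] c0 ch z z01.
  have /andP[z0 z1] : 0 < z < 1 by rewrite in_itv/= in z01.
  rewrite mulr0 eseries0// => k _ _.
  suff -> : c k = 0 by rewrite mulr0 mul0r.
  have ck0 : (0 <= (c k * z ^+ k)%:E)%E by rewrite lee_fin mulr_ge0// exprn_ge0// ltW.
  apply/eqP; rewrite -(@mulIr_eq0 _ (z ^+ k)); last exact/mulIf/expf_neq0/lt0r_neq0.
  rewrite eq_le; apply/andP; split; last by rewrite -lee_fin.
  have := @sum_nneg_series_bound _ (fun j => c j * z ^+ j) 0 k.+1.
  rewrite big_nat_recr//= => ub; apply: le_trans (ub _ _).
  - by rewrite lerDr sumr_ge0// => j _; rewrite mulr_ge0// exprn_ge0// ltW.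
  - by move=> j; rewrite mulr_ge0// exprn_ge0// ltW.
  - by rewrite ch// mulr0.
have cC0 k : 0 <= C^-1 * c k by rewrite mulr_ge0// invr_ge0 ltW.
have cCE w : w \in `]0, 1[ ->
    (\sum_(0 <= k <oo) ((C^-1 * c k) * w ^+ k)%:E = (h w)%:E)%E.
  move=> w01; under eq_eseriesr do rewrite -mulrA EFinM.
  rewrite nneseriesZl ?ch//; last first.
    move=> k _; rewrite lee_fin mulr_ge0// exprn_ge0//.
    by move: w01; rewrite in_itv/= => /andP[/ltW].
  by rewrite -EFinM mulrCA mulVf ?mulr1// gt_eqF.
rewrite mulrC EFinM -(nneg_pseries_derive1n i cC0 cCE z01) -nneseriesZl; last first.
  move=> k _; rewrite lee_fin !mulr_ge0 ?exprn_ge0 ?invr_ge0 ?(ltW C0)//.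
  by move: z01; rewrite in_itv/= => /andP[/ltW].
apply: eq_eseriesr => k _; rewrite -EFinM; congr EFin.
by field; rewrite gt_eqF.
Qed.

(** * The Gamma and Beta integrals *)

(** The exponential exceeds the Taylor term of degree [n.+1]. *)
Lemma cvg_exprn_expRN (R : realType) n :
  t ^+ n * expR (- t) @[t --> +oo%R] --> (0 : R).
Proof.
apply: (@squeeze_cvgr _ _ _ _ (cst 0) (fun t : R => n.+1`!%:R * t^-1)).
- near=> t.
  have t0 : 0 < t by near: t; exact: nbhs_pinfty_gt.
  rewrite mulr_ge0 ?exprn_ge0 ?expR_ge0 ?(ltW t0)//=.
  rewrite expRN ler_pdivrMr ?expR_gt0// mulrAC ler_pdivlMr// -exprSr.
  have : t ^+ n.+1 / n.+1`!%:R <= expR t.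
    by apply: le_trans (expR_ge1Dxn n (ltW t0)); rewrite lerDr.
  by rewrite ler_pdivrMr ?ltr0n ?fact_gt0// mulrC.
- exact: cvg_cst.
- rewrite -[X in _ --> X](mulr0 n.+1`!%:R); apply: cvgMl_tmp.
  apply/gtr0_cvgV0.
    by near=> t; near: t; exact: nbhs_pinfty_gt.
  by apply: cvg_id.
Unshelve. all: by end_near.
Qed.

Lemma is_derive_expRN (R : realType) (t : R) :
  is_derive t (1 : R) (fun x => expR (- x)) (- expR (- t)).
Proof.
have D := is_derive1_comp (is_derive_expR (- t)) (is_deriveNid t (1 : R)).
by apply: (is_derive_eq D); rewrite mulrN1.
Qed.

(** Integration by parts: [F_(n+1) = (n + 1) F_n - t^(n+1) e^(-t)]. *)
Lemma gamma_primitive (R : realType) (n : nat) : exists F : R -> R,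
  [/\ forall t : R, is_derive t (1 : R) F (t ^+ n * expR (- t)),
      F t @[t --> +oo%R] --> (0 : R) & F 0 = - n`!%:R].
Proof.
elim: n => [|n [F [dF cF F0]]].
  exists (- (fun t => expR (- t))); split.
  - move=> t; rewrite expr0 mul1r -[X in is_derive _ _ _ X]opprK.
    exact/is_deriveN/is_derive_expRN.
  - rewrite -oppr0; apply: cvgN.
    by have := @cvg_exprn_expRN R 0; under eq_fun do rewrite expr0 mul1r.
  - by rewrite fctE oppr0 expR0 fact0.
exists (n.+1%:R *: F - (fun t => t ^+ n.+1) * (fun t => expR (- t))); split.
- move=> t.
  have DX : is_derive t (1 : R) (fun x => x ^+ n.+1) (n.+1%:R * t ^+ n).
    by apply: DeriveDef; [exact: exprn_derivable|rewrite exp_derive scaler1].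
  pose D := is_deriveB (is_deriveZ n.+1%:R (dF t))
    (is_deriveM DX (is_derive_expRN t)).
  apply: (is_derive_eq D).
  by rewrite /GRing.scale/= /GRing.scale/=; ring.
- rewrite -[X in _ --> X]subr0 -[X in _ --> X - _](mulr0 n.+1%:R).
  apply: cvgB; last exact: cvg_exprn_expRN.
  exact: cvgMl_tmp.
- by rewrite !fctE /= F0 expr0n/= mul0r subr0 factS natrM /GRing.scale/= mulrN.
Qed.

Lemma Gamma_fact (R : realType) n : Gamma (n.+1%:R : R) = n`!%:R.
Proof.
have [F [dF cF F0]] := gamma_primitive R n.
have Fc : continuous F.
  by move=> t; apply/differentiable_continuous/derivable1_diffP; case: (dF t).
have fc : continuous (fun t : R => t ^+ n * expR (- t)).
  move=> t; apply: cvgM; first exact: exprn_continuous.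
  by apply: continuous_comp; [exact: continuousN|exact: continuous_expR].
rewrite /Gamma /Rintegral.
transitivity (fine (\int[lebesgue_measure]_(t in `]0%R, +oo[)
  ((t : R) ^+ n * expR (- (t : R)))%:E)%E).
  congr fine; apply: eq_integral => t.
  rewrite inE/= in_itv/= andbT => t0.
  by rewrite -natr1 addrK powR_mulrn// ltW.
rewrite integral_itv_obnd_cbnd; last first.
  apply/measurable_EFinP; apply: measurable_funTS; exact: continuous_measurable_fun.
rewrite (@ge0_continuous_FTC2y _ _ F 0 0)//.
- by rewrite F0 sub0e EFinN oppeK.
- by move=> t t0; rewrite mulr_ge0 ?exprn_ge0 ?expR_ge0.
- exact: continuous_subspaceT.
- exact/cvg_at_right_filter/Fc.
- by move=> t _; rewrite derive1E derive_val.
Qed.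

(** This is the value [(N-i)! (i-1)! / N!] of the Beta integral; the factor
    [1 / Gamma(i)] of the main formulas comes from here. *)
Lemma ffactV_beta (R : realType) (N i : nat) : (0 < i <= N)%N ->
  (((N ^_ i)%:R^-1 : R)%:E = ((Gamma (i%:R : R))^-1)%:E *
    \int[lebesgue_measure]_(z in `]0%R, 1%R[)
      ((1 - z) ^+ (i - 1) * z ^+ (N - i))%:E)%E.
Proof.
case: i => [|i] iN; first by [].
rewrite Gamma_fact subn1 [i.+1.-1]/=.
have h : (((N - i.+1)`! * i`!)%:R / (N - i.+1 + i).+1`!%:R)%:E =
    (\int[lebesgue_measure]_(z in `]0%R, 1%R[) (XMonemX (N - i.+1) i (z : R))%:E)%E.
  rewrite -beta_fun_fact EFin_beta_fun -(@integral_itv_bndoo _ _ _ _ true false).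
    by rewrite [RHS]integral_mkcond; apply: eq_integral => z _; rewrite restrict_EFin.
  apply/measurable_EFinP/measurable_funTS; apply: continuous_measurable_fun => t.
  by apply: cvgM; [exact: exprn_continuous|exact: continuous_onemXn].
under eq_integral do rewrite mulrC.
rewrite -[X in (_ * X)%E]h -EFinM; congr EFin.
rewrite -addnS subnK// -(ffact_fact iN) [((N - i.+1)`! * i`!)%:R]natrM [(N ^_ i.+1 * _)%:R]natrM.
have iR : i`!%:R != 0 :> R by rewrite pnatr_eq0 -lt0n fact_gt0.
have jR : (N - i.+1)`!%:R != 0 :> R by rewrite pnatr_eq0 -lt0n fact_gt0.
have kR : (N ^_ i.+1)%:R != 0 :> R by rewrite pnatr_eq0 -lt0n ffact_gt0.
move: (i`!%:R : R) ((N - i.+1)`!%:R : R) ((N ^_ i.+1)%:R : R) iR jR kR => a b e a0 b0 e0.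
by field; rewrite a0 b0 e0.
Qed.

(** * Founders and coalescence in a fixed genealogy *)

Section GenealogyTheory.
Variables (imm : nat -> nat) (off : nat -> nat -> nat).
Local Notation born := (born imm off).
Local Notation pop := (pop imm off).
Local Notation litters := (litters imm off).
Local Notation parent := (parent imm off).
Local Notation ancestor := (ancestor imm off).
Local Notation coalesced := (coalesced imm off).

Lemma size_litters k : size (litters k) = pop k.
Proof. by rewrite size_mkseq. Qed.

Lemma bornS k : born k.+1 = sumn (litters k).
Proof. by rewrite /= sumnE big_map /index_iota subn0. Qed.

Lemma parentP k c : (c < born k.+1)%N ->
  exists2 j, parent k c = Some j & (j < pop k)%N.
Proof.
move=> cb; rewrite /parent cb; eexists; first by [].
by rewrite -size_litters; apply: reshape_indexP; rewrite -bornS.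
Qed.

Lemma parent_immigrant k c : (born k.+1 <= c)%N -> parent k c = None.
Proof. by move=> bc; rewrite /parent ltnNge bc. Qed.

(** The line of [c] is traced back to generation [m] or to an immigrant,
    whichever it meets first.  The value is a pair (generation, number). *)
Fixpoint founder (m n c : nat) : nat * nat :=
  if n is n'.+1 then
    if (n' < m)%N then (n, c)
    else if parent n' c is Some a then founder m n' a else (n, c)
  else (n, c).

(** Meant for [m <= k]: the lines that are traced back stop at these individuals. *)
Definition is_founder (m k a : nat) : bool := (k == m) || (born k <= a)%N.

Lemma founder_refl m k a : (m <= k)%N -> is_founder m k a ->
  founder m k a = (k, a).
Proof.
case: k => [//|k] mk /orP[/eqP km|bk] /=; first by rewrite -km ltnSn.
by case: ifP => // _; rewrite parent_immigrant.
Qed.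

Lemma founderP m n c k a : (m <= n)%N -> founder m n c = (k, a) ->
  [/\ (m <= k <= n)%N, ancestor n (n - k) c = Some a & is_founder m k a].
Proof.
elim: n c => [|n ih] c /=.
  by rewrite leqn0 => /eqP -> [<- <-]; rewrite /is_founder eqxx.
rewrite leq_eqVlt => /predU1P[->|]; last rewrite ltnS => mn.
  by rewrite ltnSn => -[<- <-]; rewrite /is_founder eqxx leqnn subnn.
rewrite ltnNge mn /=; case pc: (parent n c) => [a'|].
  move=> /(ih _ mn)[/andP[mk kn] anc fk]; split => //.
    by rewrite mk ltnW.
  by rewrite subSn//= pc.
move=> [<- <-]; split; [by rewrite leqnn leqW| by rewrite subnn|].
apply/orP; right; rewrite leqNgt; apply/negP => /parentP[j]; by rewrite pc.
Qed.

(** Tracing back can start from any point of the line. *)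
Lemma founder_ancestor m n c k a : (m <= k <= n)%N ->
  ancestor n (n - k) c = Some a -> founder m n c = founder m k a.
Proof.
elim: n c => [|n ih] c /=.
  by rewrite leqn0 => /andP[mk /eqP ->] [->].
move=> /andP[mk]; rewrite leq_eqVlt => /predU1P[->|]; last rewrite ltnS => kn.
  by rewrite subnn => -[->].
rewrite subSn//= ltnNge (leq_trans mk kn)/=; case: (parent n c) => [a'|//] /=.
by apply: ih; rewrite mk.
Qed.

Lemma founder_eq m n c k a : (m <= k <= n)%N -> is_founder m k a ->
  (founder m n c == (k, a)) = (ancestor n (n - k) c == Some a).
Proof.
move=> mkn fka; have /andP[mk kn] := mkn.
apply/eqP/eqP => [/founderP[]//|anc]; first exact: leq_trans kn.
by rewrite (founder_ancestor mkn anc) founder_refl.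
Qed.

Lemma ancestor_lt n b c a : (b <= n)%N -> (c < pop n)%N ->
  ancestor n b c = Some a -> (a < pop (n - b))%N.
Proof.
elim: b n c => [|b ih] n c bn cn; first by rewrite subn0; case: n bn cn => [|n] _ ? /= [<-].
case: n bn cn => // n bn cn /=.
case: (ltnP c (born n.+1)) => [/parentP[j -> jn]|/parent_immigrant -> //] /=.
exact: ih.
Qed.

Lemma founder_ltn m n c k a : (m < n)%N -> (c < born n)%N ->
  founder m n c = (k, a) -> (k < n)%N.
Proof.
case: n => // n; rewrite ltnS => mn cn /=; rewrite ltnNge mn/=.
by have [j -> _] := parentP cn => /(founderP mn)[/andP[_ kn] _ _].
Qed.

(** Immigrants of generation [n] are left out, since the sampled individuals
    are born in the system. *)
Definition founders (m n : nat) : seq (nat * nat) :=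
  [seq (m, a) | a <- iota 0 (born m)] ++
  [seq (k, a) | k <- iota m (n - m), a <- iota (born k) (imm k)].

Lemma mem_founders m n k a : (m < n)%N ->
  (k, a) \in founders m n = [&& (m <= k < n)%N, (a < pop k)%N & is_founder m k a].
Proof.
move=> mn; rewrite mem_cat; apply/orP/and3P => [[|]|[/andP[mk kn] ak]].
- case/mapP => a'; rewrite mem_iota add0n /= => a'b [-> ->].
  by rewrite leqnn mn /is_founder eqxx /Defs.pop ltn_addr.
- case/allpairsPdep => k' [a'] []; rewrite !mem_iota (subnKC (ltnW mn)) => mk.
  by move=> /andP[ba ap] [-> ->]; rewrite mk /is_founder ba orbT.
case/orP => [/eqP km|ba].
  case: (ltnP a (born k)) => [ab|ba].
    by left; rewrite km in ab *; apply/mapP; exists a => //; rewrite mem_iota.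
  right; apply/allpairsPdep; exists k, a; split => //.
    by rewrite mem_iota mk (subnKC (ltnW mn)).
  by rewrite mem_iota ba.
right; apply/allpairsPdep; exists k, a; split => //.
  by rewrite mem_iota mk (subnKC (ltnW mn)).
by rewrite mem_iota ba.
Qed.

Lemma founders_uniq m n : uniq (founders m n).
Proof.
rewrite cat_uniq; apply/and3P; split.
- by rewrite map_inj_uniq ?iota_uniq// => a b [].
- apply/hasPn => -[k a] /allpairsPdep[k' [a' [_]]]; rewrite mem_iota => /andP[ba _].
  move=> [-> ->]; apply/negP => /mapP[a'']; rewrite mem_iota /= add0n => ab [km].
  by move=> aa; rewrite aa km leqNgt ab in ba.
- apply: allpairs_uniq_dep.
  + exact: iota_uniq.
  + by move=> k _; exact: iota_uniq.
  + by move=> [k a] [k' a'] _ _ /= [-> ->].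
Qed.

Definition descendants (n b a : nat) : nat :=
  count (fun c => ancestor n b c == Some a) (iota 0 (born n)).

Definition coalesced_since (m n : nat) (s : seq nat) : bool :=
  [exists k : 'I_n.+1, (m <= k)%N && coalesced n s k].

(** A common ancestor at a generation [>= m] is on all the lines, so these end
    at its founder; conversely a common founder is a common ancestor. *)
Lemma coalesced_since_founder m n x s : (m < n)%N ->
  all (fun c => (c < born n)%N) (x :: s) ->
  coalesced_since m n (x :: s) =
    has (fun phi => all (fun c => founder m n c == phi) (x :: s)) (founders m n).
Proof.
move=> mn xsN; have mn' := ltnW mn; apply/existsP/hasP => [[k /andP[mk]]|].
  have mkn : (m <= k <= n)%N by rewrite mk -ltnS ltn_ord.
  move=> /existsP[a /allP anc].
  have fE c : c \in x :: s -> founder m n c = founder m k a.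
    by move=> /anc/eqP; exact: founder_ancestor.
  exists (founder m k a); last by apply/allP => c /fE ->.
  have xn : (x < born n)%N by case/andP: xsN.
  case fx : (founder m k a) => [l b].
  have fx' : founder m n x = (l, b) by rewrite fE ?mem_head.
  have [/andP[ml ln] ancx lb] := founderP mn' fx'.
  have xp : (x < pop n)%N by rewrite /Defs.pop ltn_addr.
  rewrite mem_founders// ml lb (founder_ltn mn xn fx') !andbT /=.
  by have := ancestor_lt (leq_subr l n) xp ancx; rewrite (subKn ln) => ->.
case=> -[k a]; rewrite mem_founders// => /and3P[/andP[mk kn] ak fka] /allP fE.
have kn1 : (k < n.+1)%N by rewrite ltnS ltnW.
exists (Ordinal kn1); rewrite /= mk /=.
apply/existsP; exists (Ordinal ak); apply/allP => c /fE.
by rewrite founder_eq// mk ltnW.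
Qed.

(** An injective tuple coalesces when it lies within the family of one founder,
    and the families are disjoint; a family of size [Z] contains [(Z)_i] such
    tuples.  For [i = 0] the empty tuple would be counted once per founder. *)
Lemma card_coalesced_tuples m n i : (m < n)%N -> (0 < i)%N ->
  #|[set s : i.-tuple 'I_(born n) |
      uniq s && coalesced_since m n (map val s)]%SET| =
  (\sum_(0 <= a < born m) descendants n (n - m) a ^_ i +
   \sum_(m <= k < n) \sum_(born k <= a < pop k) descendants n (n - k) a ^_ i)%N.
Proof.
move=> mn i0.
have -> : [set s : i.-tuple 'I_(born n) | uniq s && coalesced_since m n (map val s)]%SET
  = (\bigcup_(phi <- founders m n) [set s : i.-tuple 'I_(born n) |
      all [pred c | founder m n (val c) == phi] s & uniq s])%SET.
  apply/setP => s; rewrite inE.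
  have -> : coalesced_since m n (map val s) =
     has (fun phi => all (fun c => founder m n c == phi) (map val s)) (founders m n).
    case: i s i0 => // i s _; case/tupleP: s => x s /=.
    rewrite -coalesced_since_founder//=.
    by rewrite ltn_ord/=; apply/allP => _ /mapP[c _ ->].
  apply/andP/idP => [[us /hasP[phi phiF sphi]]|].
    rewrite (big_rem phi)//= inE; apply/orP; left; rewrite inE us andbT.
    by move: sphi; rewrite all_map.
  elim: (founders m n) => [|phi F ih]; first by rewrite big_nil inE.
  rewrite big_cons inE /= => /orP[|/ih[-> ->]]; last by rewrite orbT.
  by rewrite inE => /andP[sphi ->]; rewrite /= all_map sphi.
have cardU : #|(\bigcup_(phi <- founders m n) [set s : i.-tuple 'I_(born n) |
      all [pred c | founder m n (val c) == phi] s & uniq s])%SET| =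
   (\sum_(phi <- founders m n) #|[set s : i.-tuple 'I_(born n) |
      all [pred c | founder m n (val c) == phi] s & uniq s]%SET|)%N.
  elim: (founders m n) (founders_uniq m n) => [|phi F ih] /=.
    by rewrite !big_nil cards0.
  move=> /andP[phiF uF]; rewrite !big_cons cardsU -ih// -[RHS]subn0; congr subn.
  apply/eqP; rewrite cards_eq0; apply/eqP/setP => s; rewrite !inE.
  apply/negP => /andP[/andP[sphi us]].
  have : has (fun psi => all [pred c | founder m n (val c) == psi] s) F -> False.
    case/hasP => psi psiF spsi.
    have [x xs] : exists x, x \in s.
      by exists (tnth s (Ordinal i0)); exact: mem_tnth.
    move: phiF; rewrite -(eqP (allP sphi _ xs)) (eqP (allP spsi _ xs)).
    by rewrite psiF.
  move=> noF; elim: F {ih phiF uF} noF => [|psi F ih] noF; first by rewrite big_nil inE.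
  rewrite big_cons inE => /orP[|/ih]; last by apply => h; apply: noF; rewrite /= h orbT.
  by rewrite inE => /andP[h _]; apply: noF; rewrite /= h.
rewrite cardU.
have cE phi : phi \in founders m n ->
    #|[set s : i.-tuple 'I_(born n) |
      all [pred c | founder m n (val c) == phi] s & uniq s]%SET| =
    (descendants n (n - phi.1) phi.2 ^_ i)%N.
  case: phi => k a; rewrite mem_founders// => /and3P[/andP[mk kn] _ fka].
  rewrite card_uniq_tuples; congr (_ ^_ _)%N.
  rewrite /descendants -val_enum_ord count_map -sum1_count -sum1_card big_enum_cond.
  apply: eq_bigl => c; rewrite !inE /=.
  by rewrite founder_eq// mk ltnW.
rewrite (eq_big_seq _ cE) big_cat /=; congr addn.
  by rewrite big_map /index_iota subn0.
rewrite big_allpairs_dep /index_iota; apply: eq_bigr => k _.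
by rewrite /Defs.pop addKn.
Qed.

End GenealogyTheory.

Lemma coalescence_timeP (R : realType) imm off m n s :
  (((m%:R)%R%:E <= coalescence_time imm off R n s < +oo)%E : bool) =
  coalesced_since imm off m n s.
Proof.
rewrite /coalescence_time; case: ifPn => [/existsP[k0 ck0]|/existsPn no]; last first.
  rewrite ltxx andbF; apply/esym/negbTE/existsPn => k.
  by rewrite negb_and no orbT.
rewrite ltry andbT lee_fin ler_nat; apply/idP/existsP => [mle|[k /andP[mk ck]]].
  have [k ck kE] := @eq_bigmax_cond _ (fun k : 'I_n.+1 => coalesced imm off n s k)
    (fun k : 'I_n.+1 => k : nat) (introT card_gt0P (ex_intro _ k0 ck0)).
  by exists k; rewrite kE in mle; rewrite mle.
apply: (leq_trans mk).
by rewrite (@leq_bigmax_cond _ _ (fun k : 'I_n.+1 => k : nat)).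
Qed.

(** * Weights along lines of descent *)

(** The index [j] is taken by [nth 0 s j] consecutive values of [c]. *)
Lemma prod_reshape_index (A : comNzRingType) (F : nat -> A) (s : seq nat) :
  \prod_(0 <= c < sumn s) F (reshape_index s c) =
  \prod_(0 <= j < size s) F j ^+ nth 0%N s j.
Proof.
elim: s F => [|k s ih] F /=; first by rewrite !big_nil.
rewrite (big_cat_nat (n := k)) ?leq_addr//= big_nat_recl//=; congr (_ * _).
  rewrite (eq_big_nat _ _ (F2 := fun=> F 0%N)) ?prodr_const_nat ?subn0//.
  by move=> c /andP[_ ck]; rewrite /reshape_index/= subn_eq0 ck.
rewrite -[X in \prod_(X <= _ < _) _]add0n big_addn addKn -(ih (F \o succn)).
apply: eq_big_nat => c _; congr F.
by rewrite /reshape_index/= subn_eq0 ltnNge leq_addl/= subSn ?leq_addl// addnK.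
Qed.

Section Weights.
Variables (R : comNzRingType) (imm : nat -> nat) (off : nat -> nat -> nat).
Local Notation born := (born imm off).
Local Notation pop := (pop imm off).
Local Notation litters := (litters imm off).
Local Notation ancestor := (ancestor imm off).

(** Over a generation of [N] individuals, [Z] of them descendants of [a], the
    product of the weights is the monomial [x^Z y^(N-Z)]; as a product it can be
    regrouped by parents. *)
Definition weight (x y : R) (n b a c : nat) : R :=
  if ancestor n b c == Some a then x else y.

(** A child descends from [a] exactly when its parent does, so it inherits the
    weight of its parent. *)
Lemma prod_weight_parents x y n b a :
  \prod_(0 <= c < born n.+1) weight x y n.+1 b.+1 a c =
  \prod_(0 <= j < pop n) weight x y n b a j ^+ off n j.
Proof.
rewrite bornS (eq_big_nat _ _
  (F2 := fun c => weight x y n b a (reshape_index (litters n) c))); last first.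
  move=> c /andP[_ cn]; rewrite /weight /= /parent -/(Defs.litters _ _ _).
  by rewrite -/(Defs.born imm off n.+1) bornS cn.
rewrite prod_reshape_index size_litters; apply: eq_big_nat => j /andP[_ jn].
by rewrite nth_mkseq.
Qed.

Lemma weight_immigrant x y n b a j : (born n <= j)%N -> (0 < b)%N ->
  weight x y n b a j = y.
Proof.
by rewrite /weight; case: n b => [|n] [|b]//= nj _; rewrite parent_immigrant.
Qed.

Lemma prod_weight_pop x y n b a : (0 < b)%N ->
  \prod_(0 <= j < pop n) weight x y n b a j =
  \prod_(0 <= j < born n) weight x y n b a j * y ^+ imm n.
Proof.
move=> b0; rewrite (big_cat_nat (n := born n)) ?leq_addr//=; congr (_ * _).
rewrite (eq_big_nat _ _ (F2 := fun=> y)) ?prodr_const_nat ?addKn//.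
by move=> j /andP[nj _]; exact: weight_immigrant.
Qed.

Lemma weight0 x y n a c : weight x y n 0 a c = if c == a then x else y.
Proof. by case: n. Qed.

Lemma prod_weight0 x y n a : (a < pop n)%N ->
  \prod_(0 <= j < pop n) weight x y n 0 a j = x * y ^+ (pop n).-1.
Proof.
move=> an; rewrite big_mkord (bigD1 (Ordinal an))//= weight0 eqxx; congr (_ * _).
rewrite (eq_bigr (fun=> y)); last first.
  by move=> j ja; rewrite weight0 ifN.
rewrite prodr_const; congr (_ ^+ _).
by rewrite cardC1 card_ord.
Qed.

Lemma prod_weight_descendants x y n b a :
  \prod_(0 <= c < born n) weight x y n b a c =
  x ^+ descendants imm off n b a * y ^+ (born n - descendants imm off n b a).
Proof.
rewrite (bigID (fun c => ancestor n b c == Some a))/=; congr (_ * _).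
  rewrite (eq_bigr (fun=> x)); last by rewrite /weight => c ->.
  by rewrite big_const_seq iter_mulr_1 /index_iota subn0.
rewrite (eq_bigr (fun=> y)); last by rewrite /weight => c /negbTE ->.
rewrite big_const_seq iter_mulr_1 /index_iota subn0 /descendants; congr (_ ^+ _).
rewrite -[X in (X - _)%N](size_iota 0).
by rewrite -(count_predC (fun c => ancestor n b c == Some a)) addKn.
Qed.

End Weights.

(** * The genealogy depends on the litters only *)

Section Congruence.
Variables (imm imm' : nat -> nat) (off off' : nat -> nat -> nat) (n : nat).
Hypothesis eqL : forall k, (k < n)%N -> litters imm off k = litters imm' off' k.

Lemma born_congr k : (k <= n)%N -> born imm off k = born imm' off' k.
Proof. by case: k => // k kn; rewrite !bornS eqL. Qed.

Lemma pop_congr k : (k < n)%N -> pop imm off k = pop imm' off' k.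
Proof. by move=> kn; rewrite -!size_litters eqL. Qed.

Lemma imm_congr k : (k < n)%N -> imm k = imm' k.
Proof.
move=> kn; have := pop_congr kn; rewrite /pop born_congr; last exact: ltnW.
exact: addnI.
Qed.

Lemma off_congr k j : (k < n)%N -> (j < pop imm off k)%N -> off k j = off' k j.
Proof.
move=> kn jk; rewrite -(nth_mkseq 0%N (off k) jk) -[mkseq _ _]/(litters imm off k).
by rewrite eqL// nth_mkseq// -pop_congr.
Qed.

Lemma ancestor_congr k b c : (k <= n)%N ->
  ancestor imm off k b c = ancestor imm' off' k b c.
Proof.
elim: b k c => [|b ih] [|k] c //= kn.
have -> : parent imm off k c = parent imm' off' k c.
  by rewrite /parent born_congr// eqL.
by case: parent => //= a; exact/ih/ltnW.
Qed.

End Congruence.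

Lemma coalesced_since_congr imm imm' off off' m n s :
  (forall k, (k < n.+1)%N -> litters imm off k = litters imm' off' k) ->
  coalesced_since imm off m n s = coalesced_since imm' off' m n s.
Proof.
move=> eqL; apply: eq_existsb => k; congr (_ && _); rewrite /coalesced.
have pE : pop imm off k = pop imm' off' k by exact: pop_congr (ltn_ord k).
apply/existsP/existsP => -[a h].
  exists (cast_ord pE a); rewrite -(eq_all (a1 := fun c =>
    ancestor imm off n (n - k) c == Some (val a)))// => c.
  by rewrite (ancestor_congr eqL).
exists (cast_ord (esym pE) a); rewrite (eq_all (a2 := fun c =>
  ancestor imm' off' n (n - k) c == Some (val a)))// => c.
by rewrite (ancestor_congr eqL).
Qed.

Lemma litters_congr_cells imm imm' off off' n :
  (forall k, (k < n)%N -> imm k = imm' k) ->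
  (forall k j, (k < n)%N -> (j < pop imm' off' k)%N -> off k j = off' k j) ->
  forall k, (k < n)%N -> litters imm off k = litters imm' off' k.
Proof.
move=> iE oE; elim=> [|k ih] kn.
  rewrite /litters /pop /= iE//; apply/eq_in_map => j; rewrite mem_iota => /andP[_ j0].
  exact: oE.
have bE : born imm off k.+1 = born imm' off' k.+1 by rewrite !bornS ih// ltnW.
rewrite /litters /pop bE iE//; apply/eq_in_map => j; rewrite mem_iota => /andP[_ jk].
exact: oE.
Qed.

(** * Random elements with countably many values *)

Section Fibers.
Context {d : measure_display} {Omega : measurableType d} {R : realType}.
Variables (T : countType) (X : Omega -> T).
Hypothesis mX : forall t, measurable [set w | X w = t].

(** Indexing by codes makes the partition of [Omega] a sequence, some of whose
    members may be empty. *)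
Definition fiber (j : nat) : set Omega := [set w | choice.pickle (X w) = j].

Lemma fiberP j : fiber j = set0 \/ exists w0, fiber j = [set w | X w = X w0].
Proof.
have [j0|/set0P[w0 jw0]] := eqVneq (fiber j) set0; [by left|right].
exists w0; rewrite -jw0; apply/seteqP; split=> w /=.
  exact: (pcan_inj choice.pickleK).
by move=> wE; rewrite /fiber/= wE.
Qed.

Lemma measurable_fiber j : measurable (fiber j).
Proof. by have [->|[w0 ->]] := fiberP j. Qed.

Lemma bigcup_fiber : \bigcup_j fiber j = setT.
Proof. by apply/seteqP; split => // w _; exists (choice.pickle (X w)). Qed.

Lemma trivIset_fiber : trivIset setT fiber.
Proof. by move=> i j _ _ [w [/= <- <-]]. Qed.

Lemma measurable_set_fibers (A : set Omega) :
  (forall w w', X w = X w' -> A w -> A w') -> measurable A.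
Proof.
move=> AX; rewrite -[A]setIT -bigcup_fiber setI_bigcupr.
apply: bigcupT_measurable => j; have [->|[w0 ->]] := fiberP j.
  by rewrite setI0.
have [Aw0|nAw0] := pselect (A w0).
  rewrite (_ : _ `&` _ = [set w | X w = X w0])//.
  by apply/seteqP; split=> w /=; [case|move=> wE; split=> //; exact: AX Aw0].
rewrite (_ : _ `&` _ = set0)//; apply/seteqP; split=> // w [/= Aw wE].
exact/nAw0/(AX w).
Qed.

Lemma measurable_fun_fibers d' (V : measurableType d') (F : Omega -> V) :
  (forall w w', X w = X w' -> F w = F w') -> measurable_fun setT F.
Proof.
move=> FX _ B mB; rewrite setTI; apply: measurable_set_fibers => w w' /FX /= ww'.
by rewrite /preimage/= ww'.
Qed.

Lemma ge0_integral_fibers (mu : {measure set Omega -> \bar R}) (F : Omega -> \bar R) :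
  measurable_fun setT F -> (forall w, 0 <= F w)%E ->
  (\int[mu]_w F w = \sum_(0 <= j <oo) \int[mu]_(w in fiber j) F w)%E.
Proof.
move=> mF F0; rewrite -bigcup_fiber ge0_integral_bigcup//.
- exact: measurable_fiber.
- by rewrite bigcup_fiber.
- exact: trivIset_fiber.
Qed.

Lemma eq_ge0_integral_fibers (mu : {measure set Omega -> \bar R})
    (F G : Omega -> \bar R) :
  measurable_fun setT F -> measurable_fun setT G ->
  (forall w, 0 <= F w)%E -> (forall w, 0 <= G w)%E ->
  (forall w0, \int[mu]_(w in [set w | X w = X w0]) F w =
              \int[mu]_(w in [set w | X w = X w0]) G w)%E ->
  (\int[mu]_w F w = \int[mu]_w G w)%E.
Proof.
move=> mF mG F0 G0 FG; rewrite !ge0_integral_fibers//.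
apply: eq_eseriesr => j _; have [->|[w0 ->]] := fiberP j; last exact: FG.
by rewrite !integral_set0.
Qed.

End Fibers.

Section FiberFubini.
Context {d d' : measure_display} {Omega : measurableType d} {S : measurableType d'}.
Context {R : realType}.
Variables (P : {finite_measure set Omega -> \bar R}) (nu : {measure set S -> \bar R}).
Variables (T : countType) (X : Omega -> T).
Hypothesis mX : forall t, measurable [set w | X w = t].
Variables (D : set S) (H : Omega -> S -> \bar R).
Hypothesis mD : measurable D.
Hypothesis HX : forall w w' z, X w = X w' -> H w z = H w' z.
Hypothesis mH : forall w, measurable_fun D (H w).
Hypothesis H0 : forall w z, D z -> (0 <= H w z)%E.

Let fiber_integral j z := (\int[P]_(w in fiber X j) H w z)%E.

Let fiber_integralE j : fiber_integral j = cst 0%E \/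
  exists w0, fiber_integral j = fun z => (H w0 z * P [set w | X w = X w0])%E.
Proof.
have [j0|[w0 jw0]] := fiberP X j; [left|right; exists w0].
  by apply/funext => z; rewrite /fiber_integral j0 integral_set0.
apply/funext => z; rewrite /fiber_integral jw0.
rewrite (eq_integral (fun=> H w0 z)) ?integral_cst// => w; rewrite inE /=.
exact: HX.
Qed.

Let measurable_fiber_integral j : measurable_fun D (fiber_integral j).
Proof.
have [->|[w0 ->]] := fiber_integralE j; first exact: measurable_cst.
rewrite -(@fineK _ (P [set w | X w = X w0])); last exact: fin_num_measure.
under eq_fun do rewrite muleC.
exact: measurable_funeM.
Qed.

Let series_fiber_integral z : D z ->
  (\int[P]_w H w z = \sum_(0 <= j <oo) fiber_integral j z)%E.
Proof.
move=> Dz; rewrite (ge0_integral_fibers mX)//.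
- by apply: (measurable_fun_fibers mX) => w w'; exact: HX.
- by move=> w; exact: H0.
Qed.

Let fiber_integral_ge0 j z : D z -> (0 <= fiber_integral j z)%E.
Proof. by move=> Dz; apply: integral_ge0 => w _; exact: H0. Qed.

Lemma measurable_integral_fibers : measurable_fun D (fun z => \int[P]_w H w z)%E.
Proof.
apply: (@eq_measurable_fun _ _ _ _ _
  (fun z => \sum_(0 <= j <oo | j \in xpredT) fiber_integral j z)%E).
  by move=> z; rewrite inE => Dz; rewrite series_fiber_integral.
apply: ge0_emeasurable_sum => [j z Dz _|j _]; first exact: fiber_integral_ge0.
exact: measurable_fiber_integral.
Qed.

(** The integral over [Omega] is a series over the fibers, which can be
    exchanged with the other integral. *)
Lemma fubini_fibers :
  (\int[P]_w \int[nu]_(z in D) H w z = \int[nu]_(z in D) \int[P]_w H w z)%E.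
Proof.
rewrite (ge0_integral_fibers mX); last 2 first.
- apply: (measurable_fun_fibers mX) => w w' ww'.
  by apply: eq_integral => z _; exact: HX.
- by move=> w; apply: integral_ge0 => z; exact: H0.
rewrite [RHS](eq_integral (fun z => \sum_(0 <= j <oo) fiber_integral j z)%E); last first.
  by move=> z; rewrite inE => /series_fiber_integral ->.
rewrite integral_nneseries//.
apply: eq_eseriesr => j _.
have [j0|[w0 jw0]] := fiberP X j.
  rewrite j0 integral_set0 integral0_eq// => z _.
  by rewrite /fiber_integral j0 integral_set0.
have mF : measurable [set w | X w = X w0] by exact: mX.
rewrite jw0 (eq_integral (fun=> \int[nu]_(z in D) H w0 z)%E); last first.
  by move=> w; rewrite inE /= => ww0; apply: eq_integral => z _; exact: HX.
rewrite integral_cst// -ge0_integralZr//; last by move=> z; exact: H0.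
apply: eq_integral => z _; rewrite /fiber_integral jw0.
rewrite (eq_integral (fun=> H w0 z)) ?integral_cst// => w; rewrite inE /=.
exact: HX.
Qed.

End FiberFubini.

(** * Expectations of products of independent variables *)

Section Independence.
Context {d : measure_display} {Omega : measurableType d} {R : realType}.
Variables (P : probability Omega R) (K : choiceType) (X : K -> {RV P >-> nat}).
Hypothesis indepX : mutually_independent X.

Definition cylinder (J : seq K) (B : K -> set nat) : set Omega :=
  [set w | forall k, k \in J -> B k (X k w)].

Lemma measurable_RV_nat (Y : {RV P >-> nat}) (B : set nat) : measurable (Y @^-1` B).
Proof. by rewrite -[_ @^-1` _]setTI; exact: measurable_funPT. Qed.

Lemma measurable_fun_RV_nat d' (V : measurableType d') (Y : {RV P >-> nat}) (u : nat -> V) :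
  measurable_fun setT (fun w => u (Y w)).
Proof. by move=> _ B _; rewrite setTI; exact: (measurable_RV_nat Y (u @^-1` B)). Qed.

Lemma cylinder_cons k J B : cylinder (k :: J) B = X k @^-1` B k `&` cylinder J B.
Proof.
apply/seteqP; split=> w /= => [h|[hk hJ] k']; last by rewrite in_cons => /predU1P[->|/hJ].
by split; [exact/h/mem_head|move=> k' k'J; apply: h; rewrite in_cons k'J orbT].
Qed.

Lemma measurable_cylinder J B : measurable (cylinder J B).
Proof.
elim: J => [|k J ih].
  by rewrite (_ : cylinder _ _ = setT)//; apply/seteqP; split.
by rewrite cylinder_cons; apply: measurableI => //; exact: measurable_RV_nat.
Qed.

Lemma probability_cylinder J B : uniq J ->
  P (cylinder J B) = (\prod_(k <- J) P (X k @^-1` B k))%E.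
Proof.
move=> uJ; have := indepX [fset k in J]%fset (fun k => I : measurable (B k)).
have -> : \bigcap_(k in [set` [fset k in J]%fset]) X k @^-1` B k = cylinder J B.
  apply/seteqP; split=> w /= h k kJ; apply: h; first by rewrite /= inE.
  by move: kJ; rewrite /= inE.
move=> ->; apply: perm_big; apply: uniq_perm => // k.
by rewrite inE.
Qed.

Lemma cylinder_add k J B (j : nat) : k \notin J ->
  cylinder J B `&` [set w | X k w = j] =
  cylinder (k :: J) (fun k' => if k' == k then [set j] else B k').
Proof.
move=> kJ; rewrite cylinder_cons eqxx setIC; congr (_ `&` _).
apply/seteqP; split=> w h k' k'J; have := h k' k'J; case: eqP => // kk';
  by rewrite -kk' k'J in kJ.
Qed.

(** By induction on [J1]: on the event [X k = j] the factor [u k (X k)] is a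
    constant, and [k] moves from [J1] to [J2] with [B k] replaced by [[set j]];
    then sum over [j].  The constant [c] below can be infinite, so it is moved
    into integrals and not into series. *)
Lemma ge0_integral_cylinder_prod J1 J2 B (u : K -> nat -> R) :
  (forall k v, 0 <= u k v) -> uniq (J1 ++ J2) ->
  (\int[P]_(w in cylinder J2 B) (\prod_(k <- J1) u k (X k w))%:E =
   (\prod_(k <- J1) \int[P]_w (u k (X k w))%:E) * P (cylinder J2 B))%E.
Proof.
move=> u0; elim: J1 J2 B => [|k J1 ih] J2 B.
  move=> _; under eq_integral do rewrite big_nil.
  by rewrite big_nil mul1e integral_cst ?mul1e//; exact: measurable_cylinder.
move=> /= /andP[kJ uJ].
have kJ2 : k \notin J2 by move: kJ; rewrite mem_cat negb_or => /andP[].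
have uJ' : uniq (J1 ++ k :: J2).
  by rewrite (perm_uniq (permEl (perm_catCA J1 [:: k] J2)))/= kJ.
have mprod : measurable_fun setT (fun w => (\prod_(k <- J1) u k (X k w))%:E).
  apply/measurable_EFinP; apply: measurable_prod => k' _.
  exact: measurable_fun_RV_nat.
have prod0 w : 0 <= \prod_(k <- J1) u k (X k w) by apply: prodr_ge0 => *; exact: u0.
set c := ((\prod_(k <- J1) \int[P]_w (u k (X k w))%:E) * P (cylinder J2 B))%E.
have c0 : (0 <= c)%E.
  apply: mule_ge0 => //; apply: prode_ge0 => k' _.
  by apply: integral_ge0 => w _; rewrite lee_fin.
have mXk t : measurable [set w | X k w = t] by exact: (measurable_RV_nat (X k) [set t]).
rewrite big_cons -muleA -/c muleC.
rewrite -ge0_integralZl//; last 2 first.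
  by apply/measurable_EFinP/measurable_fun_RV_nat.
  by move=> w _; rewrite lee_fin.
rewrite [LHS]integral_mkcond.
apply: (@eq_ge0_integral_fibers _ _ _ _ (X k) mXk).
- apply/(measurable_restrictT _ _).1; first exact: measurable_cylinder.
  apply: measurable_funTS; apply/measurable_EFinP; apply: measurable_prod => k' _.
  exact: measurable_fun_RV_nat.
- by apply: measurable_funeM; apply/measurable_EFinP/measurable_fun_RV_nat.
- move=> w; apply: erestrict_ge0 => w' _; rewrite lee_fin; apply: prodr_ge0 => *.
  exact: u0.
- by move=> w; rewrite mule_ge0// lee_fin.
move=> w0.
rewrite -integral_mkcondr setIC cylinder_add//.
set B' := fun k' : K => _.
have mC := measurable_cylinder (k :: J2) B'.
transitivity (\int[P]_(w in cylinder (k :: J2) B')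
    ((u k (X k w0))%:E * (\prod_(k <- J1) u k (X k w))%:E))%E.
  apply: eq_integral => w; rewrite inE => wC; rewrite big_cons EFinM.
  by have := wC k (mem_head _ _); rewrite /B' eqxx => /= ->.
rewrite [LHS]ge0_integralZl ?lee_fin//; [|exact: measurable_funTS|by move=> w _; rewrite lee_fin].
rewrite ih// probability_cylinder; last by move: uJ'; rewrite cat_uniq => /and3P[].
rewrite big_cons {1}/B' eqxx.
have -> : (\prod_(j <- J2) P (X j @^-1` B' j) = \prod_(j <- J2) P (X j @^-1` B j))%E.
  apply: eq_big_seq =>  k' k'J; rewrite /B'; case: (k' =P k) => // kk'.
  by rewrite -kk' k'J in kJ2.
rewrite -probability_cylinder; last by move: uJ; rewrite cat_uniq => /and3P[].
rewrite (eq_integral (fun=> c * (u k (X k w0))%:E)%E); last first.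
  by move=> w; rewrite inE /= => ->.
rewrite integral_cst//.
rewrite [(P (X k @^-1` _) * _)%E]muleC [(_ * (P (cylinder _ _) * _))%E]muleA -/c.
by rewrite muleA [((u k (X k w0))%:E * c)%E]muleC.
Qed.

Lemma ge0_integral_cylinder_indep J1 J2 B (u : K -> nat -> R) :
  (forall k v, 0 <= u k v) -> uniq (J1 ++ J2) ->
  (\int[P]_(w in cylinder J2 B) (\prod_(k <- J1) u k (X k w))%:E =
   \int[P]_(w in cylinder J2 B) (\prod_(k <- J1) \int[P]_w (u k (X k w))%:E))%E.
Proof.
move=> u0 uJ; rewrite ge0_integral_cylinder_prod// integral_cst//.
exact: measurable_cylinder.
Qed.

End Independence.

(** * Averaging over one generation *)

Section Process.
Context {d : measure_display} {Omega : measurableType d} {R : realType}.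
Variables (P : probability Omega R) (M I : {RV P >-> nat}).
Variables (imm : nat -> {RV P >-> nat}) (xi : nat -> nat -> {RV P >-> nat}).
Hypothesis imm_law : forall n, distribution P (imm n) = distribution P I.
Hypothesis xi_law : forall n j, distribution P (xi n j) = distribution P M.
Hypothesis indep : mutually_independent (gwi_family imm xi).

Let f : R -> R := pgf P M.
Let g : R -> R := pgf P I.

Definition litters_at (w : Omega) (k : nat) : seq nat :=
  litters (fun k => imm k w) (fun k j => xi k j w) k.
Definition pop_at (w : Omega) (k : nat) : nat :=
  pop (fun k => imm k w) (fun k j => xi k j w) k.
Definition history (n : nat) (w : Omega) : seq (seq nat) :=
  mkseq (litters_at w) n.
(** At this stage the immigrants of generation [n] have arrived, but the
    offspring of generation [n] is not yet known. *)
Definition historyI (n : nat) (w : Omega) : seq (seq nat) * nat :=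
  (history n w, imm n w).

Lemma history_eqP n w w' : history n w = history n w' <->
  forall k, (k < n)%N -> litters_at w k = litters_at w' k.
Proof.
split=> [h k kn|h].
  by rewrite -(nth_mkseq [::] (litters_at w) kn) -/(history n w) h nth_mkseq.
by apply/eq_in_map => k; rewrite mem_iota => /andP[_ kn]; exact: h.
Qed.

Lemma history_le m n w w' : (m <= n)%N ->
  history n w = history n w' -> history m w = history m w'.
Proof.
move=> mn /history_eqP h; apply/history_eqP => k km; apply: h.
exact: leq_trans mn.
Qed.

Lemma historyI_lt m n w w' : (m < n)%N ->
  history n w = history n w' -> historyI m w = historyI m w'.
Proof.
move=> mn h; rewrite /historyI (history_le (ltnW mn) h); congr pair.
by move/history_eqP : h => h; exact: (imm_congr h mn).
Qed.

Lemma Nproc_history n w w' : history n w = history n w' ->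
  Nproc imm xi n w = Nproc imm xi n w'.
Proof. by move=> /history_eqP h; exact: (born_congr h (leqnn n)). Qed.

Lemma pop_historyI n w w' : historyI n w = historyI n w' ->
  pop_at w n = pop_at w' n.
Proof. by move=> [/Nproc_history h i]; rewrite /pop_at /pop i; congr addn. Qed.

(** The variables read by the first [n] litters of the realization [w]. *)
Definition past_cells (n : nat) (w : Omega) : seq (nat + nat * nat) :=
  [seq inl k | k <- iota 0 n] ++
  [seq inr (k, j) | k <- iota 0 n, j <- iota 0 (pop_at w k)].

(** Which variables the history reads depends on the history itself, but on a
    fiber this list is fixed. *)
Lemma history_cylinder n w0 : [set w | history n w = history n w0] =
  cylinder (gwi_family imm xi) (past_cells n w0)
    (fun c => [set gwi_family imm xi c w0]).
Proof.
apply/seteqP; split=> w /= => [/history_eqP h c|h].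
  rewrite mem_cat => /orP[/mapP[k]|/allpairsPdep[k [j []]]]; rewrite !mem_iota.
    by move=> /andP[_ kn] ->; exact: (imm_congr h kn).
  move=> /andP[_ kn] /andP[_ jk] ->; apply: (off_congr h kn).
  by rewrite (pop_congr h kn).
apply/history_eqP; apply: litters_congr_cells => [k kn|k j kn jk].
  apply: (h (inl k)); rewrite mem_cat; apply/orP; left.
  by apply/mapP; exists k => //; rewrite mem_iota.
apply: (h (inr (k, j))); rewrite mem_cat; apply/orP; right.
by apply/allpairsPdep; exists k, j; rewrite !mem_iota.
Qed.

Lemma historyI_cylinder n w0 : [set w | historyI n w = historyI n w0] =
  cylinder (gwi_family imm xi) (inl n :: past_cells n w0)
    (fun c => [set gwi_family imm xi c w0]).
Proof.
rewrite cylinder_cons -history_cylinder setIC.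
by apply/seteqP; split=> w /= [h i]; [split|rewrite /historyI h i].
Qed.

Lemma measurable_history n t : measurable [set w | history n w = t].
Proof.
have [h0|/set0P[w0 <-]] := eqVneq [set w | history n w = t] set0.
  by rewrite h0.
by rewrite history_cylinder; exact: measurable_cylinder.
Qed.

Lemma measurable_historyI n t : measurable [set w | historyI n w = t].
Proof.
have [h0|/set0P[w0 <-]] := eqVneq [set w | historyI n w = t] set0.
  by rewrite h0.
by rewrite historyI_cylinder; exact: measurable_cylinder.
Qed.

Lemma past_cells_uniq n w : uniq (past_cells n w).
Proof.
rewrite cat_uniq; apply/and3P; split.
- by rewrite map_inj_uniq ?iota_uniq// => a b [].
- apply/hasPn => _ /allpairsPdep[k [j [_ _ ->]]].
  by apply/negP => /mapP[].
- apply: allpairs_uniq_dep.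
  + exact: iota_uniq.
  + by move=> k _; exact: iota_uniq.
  + by move=> [k a] [k' a'] _ _ /= [-> ->].
Qed.

Lemma present_imm_notin n w : inl n \notin past_cells n w.
Proof.
rewrite mem_cat negb_or; apply/andP; split.
  by apply/negP => /mapP[k]; rewrite mem_iota => /andP[_ kn] [nk]; rewrite nk ltnn in kn.
by apply/negP => /allpairsPdep[k [j []]].
Qed.

Lemma present_offspring_notin n j w : inr (n, j) \notin past_cells n w.
Proof.
rewrite mem_cat negb_or; apply/andP; split; first by apply/negP => /mapP[].
apply/negP => /allpairsPdep[k [j' []]]; rewrite mem_iota => /andP[_ kn] _ [nk].
by rewrite nk ltnn in kn.
Qed.

Lemma integral_same_law (X Y : {RV P >-> nat}) (u : nat -> R) :
  distribution P X = distribution P Y -> (forall v, 0 <= u v) ->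
  (\int[P]_w (u (X w))%:E = \int[P]_w (u (Y w))%:E)%E.
Proof.
move=> XY u0.
have mu : measurable_fun [set: nat] (EFin \o u) by move=> *.
have u0' v : (0 <= (EFin \o u) v)%E by rewrite lee_fin.
by rewrite -[LHS](ge0_integral_distribution X mu u0') XY ge0_integral_distribution.
Qed.

Lemma pgf_bounds (Y : Omega -> nat) (z : R) :
  (forall B, measurable (Y @^-1` B)) -> 0 <= z <= 1 ->
  (\int[P]_w (z ^+ Y w)%:E = (pgf P Y z)%:E)%E /\ 0 <= pgf P Y z <= 1.
Proof.
move=> mY /andP[z0 z1].
have mz : measurable_fun setT (fun w => (z ^+ Y w)%:E).
  move=> _ B _; rewrite setTI.
  exact: (mY ((fun v => (z ^+ v)%:E) @^-1` B)).
have i0 : (0 <= \int[P]_w (z ^+ Y w)%:E)%E.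
  by apply: integral_ge0 => w _; rewrite lee_fin exprn_ge0.
have i1 : (\int[P]_w (z ^+ Y w)%:E <= 1)%E.
  rewrite -(@probability_setT _ _ _ P) -[leRHS]mul1e -integral_cst//.
  apply: ge0_le_integral => //.
  - by move=> w _; rewrite lee_fin exprn_ge0.
  - by move=> w _; rewrite lee_fin exprn_ile1.
have fin : (\int[P]_w (z ^+ Y w)%:E)%E \is a fin_num.
  by rewrite ge0_fin_numE// (le_lt_trans i1)// ltry.
rewrite /pgf unlock fineK//; split => //.
by rewrite -!lee_fin fineK// i0.
Qed.

(** On a fiber of [historyI n] the ranges and the weights are constants, the
    offspring numbers of generation [n] are independent of the fiber and of each
    other, and each of them averages [v ^+ xi] to [f v].  The sum over [a] runs
    over founders and is carried along because its range is random. *)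
Lemma offspring_step n (lo hi : Omega -> nat) (v : Omega -> nat -> nat -> R) :
  (forall w w', historyI n w = historyI n w' -> lo w = lo w' /\ hi w = hi w') ->
  (forall w w', historyI n w = historyI n w' -> v w = v w') ->
  (forall w a j, 0 <= v w a j <= 1) ->
  (\int[P]_w (\sum_(lo w <= a < hi w)
       \prod_(0 <= j < pop_at w n) v w a j ^+ xi n j w)%:E =
   \int[P]_w (\sum_(lo w <= a < hi w)
       \prod_(0 <= j < pop_at w n) f (v w a j))%:E)%E.
Proof.
move=> lohi vE v01.
have mM : forall B, measurable (M @^-1` B) by move=> B; exact: measurable_RV_nat.
have v0 w a j : 0 <= v w a j by case/andP: (v01 w a j).
have f0 w a j : 0 <= f (v w a j) by have [_ /andP[]] := pgf_bounds mM (v01 w a j).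
apply: (eq_ge0_integral_fibers (measurable_historyI n)).
- apply: (measurable_fun_fibers (measurable_history n.+1)) => w w' h.
  have hI := historyI_lt (ltnSn n) h.
  have [-> ->] := lohi _ _ hI; rewrite (vE _ _ hI) (pop_historyI hI).
  congr EFin; apply: eq_bigr => a _; apply: eq_big_nat => j /andP[_ jn].
  move/history_eqP in h; congr (_ ^+ _); apply: (off_congr h) => //.
  by rewrite -[X in (_ < X)%N]/(pop_at w n) (pop_historyI hI).
- apply: (measurable_fun_fibers (measurable_historyI n)) => w w' hI.
  by have [-> ->] := lohi _ _ hI; rewrite (vE _ _ hI) (pop_historyI hI).
- by move=> w; rewrite lee_fin sumr_ge0// => a _; rewrite prodr_ge0// => j _; rewrite exprn_ge0.
- by move=> w; rewrite lee_fin sumr_ge0// => a _; rewrite prodr_ge0.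
move=> w0; set D := [set w | _].
have mD : measurable D by exact: measurable_historyI.
transitivity (\int[P]_(w in D) (\sum_(a <- index_iota (lo w0) (hi w0))
    (\prod_(0 <= j < pop_at w0 n) v w0 a j ^+ xi n j w)%:E))%E.
  apply: eq_integral => w; rewrite inE => /[dup] hI /pop_historyI ->.
  by have [-> ->] := lohi _ _ hI; rewrite (vE _ _ hI) sumEFin.
transitivity (\int[P]_(w in D) (\sum_(a <- index_iota (lo w0) (hi w0))
    (\prod_(0 <= j < pop_at w0 n) f (v w0 a j))%:E))%E; last first.
  apply: eq_integral => w; rewrite inE => /[dup] hI /pop_historyI ->.
  by have [-> ->] := lohi _ _ hI; rewrite (vE _ _ hI) sumEFin.
rewrite !ge0_integral_sum//; last 3 first.
- by move=> a w _; rewrite lee_fin prodr_ge0.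
- move=> a; apply/measurable_EFinP/measurable_funTS; apply: measurable_prod => j _.
  exact: (measurable_fun_RV_nat (xi n j) (fun k => v w0 a j ^+ k)).
- by move=> a w _; rewrite lee_fin prodr_ge0// => j _; rewrite exprn_ge0.
apply: eq_bigr => a _.
pose J1 : seq (nat + nat * nat) := [seq inr (n, j) | j <- iota 0 (pop_at w0 n)].
pose u (c : nat + nat * nat) (k : nat) : R :=
  if c is inr p then v w0 a p.2 ^+ k else 0.
have u0 c k : 0 <= u c k by case: c => [//|p] /=; rewrite exprn_ge0.
have uJ : uniq (J1 ++ inl n :: past_cells n w0).
  rewrite cat_uniq map_inj_uniq ?iota_uniq/=; last by move=> ? ? [].
  rewrite past_cells_uniq present_imm_notin !andbT negb_or; apply/andP; split.
    by apply/negP => /mapP[].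
  apply/hasPn => c cP; apply/negP => /mapP[j _ cE].
  by move: cP; rewrite cE (negPf (present_offspring_notin _ _ _)).
have := ge0_integral_cylinder_indep indep
  (fun c => [set gwi_family imm xi c w0]) u0 uJ.
rewrite -historyI_cylinder -/D big_map /index_iota subn0.
under [in X in X = _ -> _]eq_integral do rewrite big_map.
move=> ->; apply: eq_integral => w _; rewrite -prodEFin; apply: eq_bigr => j _ /=.
rewrite (integral_same_law (xi_law n j) (u := fun k => v w0 a j ^+ k)).
  by have [] := pgf_bounds mM (v01 w0 a j).
by move=> k; rewrite exprn_ge0.
Qed.

(** The immigrants of generation [n] are independent of the first [n] litters. *)
Lemma immigration_step n (Y : Omega -> R) (u : nat -> R) :
  (forall w w', history n w = history n w' -> Y w = Y w') ->
  (forall w, 0 <= Y w) -> (forall k, 0 <= u k) ->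
  (\int[P]_w (Y w * u (imm n w))%:E =
   \int[P]_w (Y w)%:E * \int[P]_w (u (I w))%:E)%E.
Proof.
move=> YE Y0 u0.
have mY : measurable_fun setT (fun w => (Y w)%:E).
  by apply: (measurable_fun_fibers (measurable_history n)) => w w' /YE ->.
have iu0 : (0 <= \int[P]_w (u (I w))%:E)%E.
  by apply: integral_ge0 => w _; rewrite lee_fin.
rewrite -ge0_integralZr//; last by move=> w _; rewrite lee_fin.
apply: (eq_ge0_integral_fibers (measurable_history n)).
- apply: (measurable_fun_fibers (measurable_historyI n)) => w w' [h ->].
  by rewrite (YE _ _ h).
- by apply: (measurable_fun_fibers (measurable_history n)) => w w' /YE ->.
- by move=> w; rewrite lee_fin mulr_ge0.
- by move=> w; rewrite mule_ge0// lee_fin.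
move=> w0; set D := [set w | _].
have mD : measurable D by exact: measurable_history.
transitivity (\int[P]_(w in D) ((Y w0)%:E * (u (imm n w))%:E))%E.
  by apply: eq_integral => w; rewrite inE => /YE ->.
transitivity (\int[P]_(w in D) ((Y w0)%:E * \int[P]_w (u (I w))%:E))%E; last first.
  by apply: eq_integral => w; rewrite inE => /YE ->.
rewrite ge0_integralZl//; last 3 first.
- apply/measurable_EFinP/measurable_funTS.
  exact: (measurable_fun_RV_nat (imm n) u).
- by move=> w _; rewrite lee_fin.
- by rewrite lee_fin.
have uJ : uniq ([:: inl n] ++ past_cells n w0).
  by rewrite /= present_imm_notin past_cells_uniq.
have := ge0_integral_cylinder_indep indep
  (fun c => [set gwi_family imm xi c w0]) (fun _ k => u0 k) uJ.
rewrite -history_cylinder -/D big_seq1.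
under [in X in X = _ -> _]eq_integral do rewrite big_seq1.
move=> ->; rewrite (integral_same_law (imm_law n) u0).
by rewrite !integral_cst// muleA.
Qed.

End Process.

(** * Generating function of a family *)

Section LineageGeneratingFunction.
Context {d : measure_display} {Omega : measurableType d} {R : realType}.
Variables (P : probability Omega R) (M I : {RV P >-> nat}).
Variables (imm : nat -> {RV P >-> nat}) (xi : nat -> nat -> {RV P >-> nat}).
Hypothesis imm_law : forall n, distribution P (imm n) = distribution P I.
Hypothesis xi_law : forall n j, distribution P (xi n j) = distribution P M.
Hypothesis indep : mutually_independent (gwi_family imm xi).

Let f : R -> R := pgf P M.
Let g : R -> R := pgf P I.
Local Notation history := (history imm xi).
Local Notation historyI := (historyI imm xi).
Local Notation pop_at := (pop_at imm xi).
Local Notation born_at n w := (Nproc imm xi n w).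

Definition weight_at (w : Omega) : R -> R -> nat -> nat -> nat -> nat -> R :=
  weight (fun k => imm k w) (fun k j => xi k j w).
Definition descendants_at (w : Omega) : nat -> nat -> nat -> nat :=
  descendants (fun k => imm k w) (fun k j => xi k j w).

Lemma measurable_RV_pre (Y : {RV P >-> nat}) : forall B, measurable (Y @^-1` B).
Proof. by move=> B; exact: measurable_RV_nat. Qed.

Lemma pgf_RV_bounds (Y : {RV P >-> nat}) z : 0 <= z <= 1 ->
  0 <= pgf P Y z <= 1.
Proof. by move=> z01; have [] := pgf_bounds P (measurable_RV_pre Y) z01. Qed.

Lemma iter_pgf_bounds l z : 0 <= z <= 1 -> 0 <= iter l f z <= 1.
Proof. by move=> z01; elim: l => //= l ih; exact: pgf_RV_bounds. Qed.

Lemma measurable_Nproc n (B : set nat) : measurable (Nproc imm xi n @^-1` B).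
Proof.
apply: (measurable_set_fibers (measurable_history imm xi n)) => w w' h.
by rewrite /preimage/= (Nproc_history h).
Qed.

Lemma weight_at_congr n w w' x y b a c : history n w = history n w' ->
  weight_at w x y n b a c = weight_at w' x y n b a c.
Proof. by move=> /history_eqP h; rewrite /weight_at /weight (ancestor_congr h). Qed.

Lemma weight_at_bounds w x y n b a c : 0 <= x <= 1 -> 0 <= y <= 1 ->
  0 <= weight_at w x y n b a c <= 1.
Proof. by rewrite /weight_at /weight; case: ifP. Qed.

Lemma offspring_weight n b (lo hi : Omega -> nat) x y :
  (forall w w', historyI n w = historyI n w' -> lo w = lo w' /\ hi w = hi w') ->
  0 <= x <= 1 -> 0 <= y <= 1 ->
  (\int[P]_w (\sum_(lo w <= a < hi w)
      \prod_(0 <= c < born_at n.+1 w) weight_at w x y n.+1 b.+1 a c)%:E =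
   \int[P]_w (\sum_(lo w <= a < hi w)
      \prod_(0 <= j < pop_at w n) weight_at w (f x) (f y) n b a j)%:E)%E.
Proof.
move=> lohi x01 y01.
rewrite (eq_integral (fun w => (\sum_(lo w <= a < hi w)
    \prod_(0 <= j < pop_at w n) weight_at w x y n b a j ^+ xi n j w)%:E)%E); last first.
  move=> w _; congr EFin; apply: eq_bigr => a _.
  exact: prod_weight_parents.
rewrite (offspring_step xi_law indep lohi); last 2 first.
- move=> w w' [h _]; apply/funext => a; apply/funext => j.
  exact: weight_at_congr.
- by move=> w a j; exact: weight_at_bounds.
apply: eq_integral => w _; congr EFin; apply: eq_bigr => a _; apply: eq_bigr => j _.
by rewrite /weight_at /weight; case: ifP.
Qed.

(** Going back one generation is [offspring_step]: the weights [x, y] become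
    [f x, f y].  The immigrants of that generation have weight [f y] and are then
    averaged out by [immigration_step], which leaves [g (f y)].  Those who live
    in the generation [m] of the founders remain in the last integral. *)
Lemma lineage_gf m b (lo hi : Omega -> nat) x y :
  (forall w w', historyI m w = historyI m w' -> lo w = lo w' /\ hi w = hi w') ->
  0 <= x <= 1 -> 0 <= y <= 1 ->
  (\int[P]_w (\sum_(lo w <= a < hi w) \prod_(0 <= c < born_at (m + b).+1 w)
      weight_at w x y (m + b).+1 b.+1 a c)%:E =
   \int[P]_w (\sum_(lo w <= a < hi w) \prod_(0 <= j < pop_at w m)
      weight_at w (iter b.+1 f x) (iter b.+1 f y) m 0 a j)%:E *
   (\prod_(1 <= s < b.+1) g (iter s f y))%:E)%E.
Proof.
move=> lohi; elim: b x y => [|b ih] x y x01 y01.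
  by rewrite big_geq// mule1 addn0; exact: offspring_weight.
have fx01 := pgf_RV_bounds M x01; have fy01 := pgf_RV_bounds M y01.
rewrite addnS offspring_weight//; last first.
  move=> w w' /(congr1 fst) h; apply: lohi; apply: historyI_lt h.
  by rewrite ltnS leq_addr.
rewrite (eq_integral (fun w => ((\sum_(lo w <= a < hi w)
   \prod_(0 <= j < born_at (m + b).+1 w)
     weight_at w (f x) (f y) (m + b).+1 b.+1 a j) *
   f y ^+ imm (m + b).+1 w)%:E)); last first.
  move=> w _; rewrite mulr_suml; congr EFin; apply: eq_bigr => a _.
  by rewrite /weight_at prod_weight_pop.
rewrite (immigration_step imm_law indep (u := fun k => f y ^+ k)); last 3 first.
- move=> w w' h.
  have hm : historyI m w = historyI m w'.
    by apply: historyI_lt h; rewrite ltnS leq_addr.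
  have [-> ->] := lohi _ _ hm; rewrite (Nproc_history h).
  apply: eq_bigr => a _; apply: eq_bigr => j _; exact: weight_at_congr.
- move=> w; apply: sumr_ge0 => a _; apply: prodr_ge0 => j _.
  by have /andP[] := weight_at_bounds w (m + b).+1 b.+1 a j fx01 fy01.
- by move=> k; rewrite exprn_ge0//; case/andP: fy01.
have [-> _] := pgf_bounds P (measurable_RV_pre I) fy01.
rewrite ih// -muleA -EFinM -!iterSr; congr (_ * _%:E)%E.
rewrite [RHS]big_ltn// [in RHS]big_add1 [LHS]mulrC; congr (_ * _).
by apply: eq_bigr => s _; rewrite -iterSr.
Qed.

End LineageGeneratingFunction.

Lemma nneseries_single (R : realType) (u : nat -> R) k0 :
  (\sum_(0 <= k <oo) (u k * (k0 == k)%:R)%:E = (u k0)%:E)%E.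
Proof.
apply/cvg_lim => //; apply: cvg_near_cst.
near=> n; have kn : (k0 < n)%N by near: n; exact: nbhs_infty_gt.
rewrite sumEFin (bigD1_seq k0) ?iota_uniq ?mem_index_iota//= eqxx mulr1.
by rewrite big1 ?addr0// => k /negbTE; rewrite eq_sym => ->; rewrite mulr0.
Unshelve. all: by end_near.
Qed.

Lemma integral_probability_cst d (T : measurableType d) (R : realType)
  (P : probability T R) (c : \bar R) : (\int[P]_w c = c)%E.
Proof. by rewrite integral_cst// [X in (_ * X)%E]probability_setT mule1. Qed.

Section FounderGeneratingFunctions.
Context {d : measure_display} {Omega : measurableType d} {R : realType}.
Variables (P : probability Omega R) (M I : {RV P >-> nat}).
Variables (imm : nat -> {RV P >-> nat}) (xi : nat -> nat -> {RV P >-> nat}).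
Hypothesis imm_law : forall n, distribution P (imm n) = distribution P I.
Hypothesis xi_law : forall n j, distribution P (xi n j) = distribution P M.
Hypothesis indep : mutually_independent (gwi_family imm xi).

Let f : R -> R := pgf P M.
Let g : R -> R := pgf P I.
Local Notation history := (history imm xi).
Local Notation historyI := (historyI imm xi).
Local Notation pop_at := (pop_at imm xi).
Local Notation weight_at := (weight_at imm xi).
Local Notation descendants_at := (descendants_at imm xi).
Local Notation born_at n w := (Nproc imm xi n w).

Section NatLaw.
Variables (Y : Omega -> nat).
Hypothesis mY : forall B, measurable (Y @^-1` B).

Let p (k : nat) : R := fine (P (Y @^-1` [set k])).

Let p_ge0 k : 0 <= p k.
Proof. by rewrite fine_ge0. Qed.

Let pE k : P (Y @^-1` [set k]) = (p k)%:E.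
Proof. by rewrite fineK// fin_num_measure//; exact: mY. Qed.

Lemma integral_nat_series (u : nat -> R) : (forall k, 0 <= u k) ->
  (\int[P]_w (u (Y w))%:E = \sum_(0 <= k <oo) (p k * u k)%:E)%E.
Proof.
move=> u0; rewrite (@ge0_integral_fibers _ _ _ _ Y).
- apply: eq_eseriesr => k _.
  rewrite (eq_integral (fun=> (u k)%:E)); last first.
    by move=> w; rewrite inE /fiber /= => <-.
  rewrite integral_cst; last exact: (mY [set k]).
  by rewrite [X in (_ * X)%E](pE k) -EFinM mulrC.
- by move=> k; exact: (mY [set k]).
- by move=> _ B _; rewrite setTI; exact: (mY ((EFin \o u) @^-1` B)).
- by move=> w; rewrite lee_fin.
Qed.

Lemma pgf_series z : 0 <= z <= 1 ->
  (\sum_(0 <= k <oo) (p k * z ^+ k)%:E = (pgf P Y z)%:E)%E.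
Proof.
move=> z01; have [<- _] := pgf_bounds P mY z01; rewrite integral_nat_series// => k.
by rewrite exprn_ge0//; case/andP: z01.
Qed.

Lemma integral_pgf_derive1 z : z \in `]0, 1[ ->
  (\int[P]_w ((Y w)%:R * z ^+ (Y w).-1)%:E = (derive1 (pgf P Y) z)%:E)%E.
Proof.
move=> z01.
have sE : {in `]0, 1[, forall z,
    (\sum_(0 <= k <oo) (p k * z ^+ k)%:E = (pgf P Y z)%:E)%E}.
  by move=> y; rewrite in_itv/= => /andP[y0 y1]; apply: pgf_series; rewrite !ltW.
have := nneg_pseries_derive1n 1 p_ge0 sE z01.
rewrite derive1n1 => <-.
rewrite (integral_nat_series (u := fun k => k%:R * z ^+ k.-1)); last first.
  move: z01; rewrite in_itv/= => /andP[z0 _] k.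
  by rewrite mulr_ge0// exprn_ge0// ltW.
by apply: eq_eseriesr => k _; rewrite ffactn1 subn1 mulrCA mulrA.
Qed.

(** [Y >= 1] almost surely, hence [pgf P Y z <= z]. *)
Lemma pgf_open : pgf P Y 0 = 0 -> forall z, z \in `]0, 1[ -> pgf P Y z \in `]0, 1[.
Proof.
move=> Y0 z /[dup] z01; rewrite !in_itv/= => /andP[z0 z1].
have zb : 0 <= z <= 1 by rewrite !ltW.
have pk0 k (y : R) : 0 <= y -> 0 <= p k * y ^+ k by move=> y0; rewrite mulr_ge0// exprn_ge0.
have p0 : p 0%N = 0.
  apply/eqP; rewrite eq_le p_ge0 andbT -Y0.
  have := sum_nneg_series_bound 1 (fun k => pk0 k 0 (lexx _)) (@pgf_series 0 _).
  by rewrite big_nat1 expr0 mulr1; apply; rewrite lexx ler01.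
apply/andP; split.
  have [k pk] : exists k, 0 < p k.
    apply: contrapT => /forallNP np.
    have : (\sum_(0 <= k <oo) (p k * 1 ^+ k)%:E = 0%:E)%E.
      apply: eseries0 => k _ _; rewrite expr1n mulr1; congr EFin.
      by apply/eqP; rewrite eq_le p_ge0 andbT leNgt; apply/negP.
    have b1 : 0 <= (1 : R) <= 1 by rewrite ler01 lexx.
    rewrite pgf_series//; have [<- _] := pgf_bounds P mY b1.
    under eq_integral do rewrite expr1n.
    by rewrite integral_probability_cst => -[] /eqP; rewrite oner_eq0.
  apply: (@lt_le_trans _ _ (p k * z ^+ k)); first by rewrite mulr_gt0// exprn_gt0.
  have := sum_nneg_series_bound k.+1 (fun k => pk0 k z (ltW z0)) (pgf_series zb).
  apply: le_trans; rewrite big_nat_recr//= lerDr sumr_ge0// => j _.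
  by rewrite pk0// ltW.
apply: (le_lt_trans _ z1); rewrite -lee_fin -pgf_series//.
have -> : z%:E = (\sum_(0 <= k <oo) (p k * z)%:E)%E.
  rewrite -(integral_nat_series (u := fun=> z)); last by move=> _; exact: ltW.
  by rewrite integral_probability_cst.
apply: lee_nneseries => [k _|k _]; rewrite lee_fin; first by rewrite pk0// ltW.
case: k => [|k]; first by rewrite p0 !mul0r.
rewrite ler_wpM2l// exprS; apply: ler_piMr; first exact: ltW.
by apply: exprn_ile1; exact: ltW.
Qed.

End NatLaw.

(** With constant weights [y], one generation gives
    [phi_(n+1)(y) = phi_n(f y) g(f y)]. *)
Lemma pgf_Nproc n y : 0 <= y <= 1 ->
  pgf P (Nproc imm xi n) y = \prod_(1 <= s < n.+1) g (iter s f y).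
Proof.
elim: n y => [|n ih] y y01; apply: EFin_inj.
  have [<- _] := pgf_bounds P (measurable_Nproc imm xi 0) y01.
  rewrite big_geq//; under eq_integral do rewrite expr0.
  by rewrite integral_probability_cst.
have [<- _] := pgf_bounds P (measurable_Nproc imm xi n.+1) y01.
have fy01 := pgf_RV_bounds M y01; have fy0 : 0 <= f y by case/andP: fy01.
transitivity (\int[P]_w (\sum_(0 <= a < 1)
    \prod_(0 <= j < pop_at w n) y ^+ xi n j w)%:E)%E.
  apply: eq_integral => w _; rewrite big_nat1; congr EFin.
  by rewrite /Nproc/= -[in LHS]prodrXr.
rewrite (offspring_step xi_law indep (lo := fun=> 0%N) (hi := fun=> 1%N)
  (v := fun _ _ _ => y))//.
transitivity (\int[P]_w (f y ^+ born_at n w * f y ^+ imm n w)%:E)%E.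
  apply: eq_integral => w _; rewrite big_nat1 prodr_const_nat subn0; congr EFin.
  by rewrite -exprD.
rewrite (immigration_step imm_law indep (u := fun k => f y ^+ k)); last 3 first.
- by move=> w w' /Nproc_history ->.
- by move=> w; rewrite exprn_ge0.
- by move=> k; rewrite exprn_ge0.
have [-> _] := pgf_bounds P (measurable_Nproc imm xi n) fy01.
have [-> _] := pgf_bounds P (measurable_RV_pre I) fy01.
rewrite ih// -EFinM; congr EFin.
rewrite [RHS]big_ltn// [in RHS]big_add1 [LHS]mulrC; congr (_ * _).
by apply: eq_bigr => s _; rewrite -iterSr.
Qed.

(** In its own generation a founder is its only descendant, so every summand
    is [x y^(N + I - 1)]; the [N] founders turn [y^(N-1)] into a derivative. *)
Lemma born_founders_gf m x y : 0 <= x <= 1 -> y \in `]0, 1[ ->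
  (\int[P]_w (\sum_(0 <= a < born_at m w)
     \prod_(0 <= j < pop_at w m) weight_at w x y m 0 a j)%:E =
   (x * (derive1 (pgf P (Nproc imm xi m)) y * g y))%:E)%E.
Proof.
move=> /andP[x0 x1] /[dup] y01; rewrite in_itv/= => /andP[y0 y1].
have yb : 0 <= y <= 1 by rewrite !ltW.
transitivity (\int[P]_w ((x * ((born_at m w)%:R * y ^+ (born_at m w).-1)) * y ^+ imm m w)%:E)%E.
  apply: eq_integral => w _; congr EFin.
  rewrite (eq_big_nat _ _ (F2 := fun=> x * y ^+ (pop_at w m).-1)); last first.
    by move=> a /andP[_ am]; apply: prod_weight0; rewrite /pop ltn_addr.
  rewrite sumr_const_nat subn0 /pop_at /pop -/(born_at m w).
  case: (born_at m w) => [|N]; first by rewrite mulr0n mul0r mulr0 mul0r.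
  by rewrite addSn/= exprD -mulr_natl; ring.
rewrite (immigration_step imm_law indep (u := fun k => y ^+ k)
  (Y := fun w => x * ((born_at m w)%:R * y ^+ (born_at m w).-1))); last 3 first.
- by move=> w w' /Nproc_history ->.
- by move=> w; rewrite !mulr_ge0// exprn_ge0// ltW.
- by move=> k; rewrite exprn_ge0// ltW.
have [-> _] := pgf_bounds P (measurable_RV_pre I) yb.
under eq_integral do rewrite EFinM.
rewrite ge0_integralZl//; last 2 first.
- move=> _ B _; rewrite setTI.
  exact: (measurable_Nproc imm xi m ((fun N => (N%:R * y ^+ N.-1)%:E) @^-1` B)).
- by move=> w _; rewrite lee_fin mulr_ge0// exprn_ge0// ltW.
by rewrite (integral_pgf_derive1 (measurable_Nproc imm xi m) y01) -!EFinM mulrA.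
Qed.

(** As in [born_founders_gf], but now the [I] immigrants are the founders. *)
Lemma immigrant_founders_gf m x y : 0 <= x <= 1 -> y \in `]0, 1[ ->
  (\int[P]_w (\sum_(born_at m w <= a < pop_at w m)
     \prod_(0 <= j < pop_at w m) weight_at w x y m 0 a j)%:E =
   (x * (derive1 g y * pgf P (Nproc imm xi m) y))%:E)%E.
Proof.
move=> /andP[x0 x1] /[dup] y01; rewrite in_itv/= => /andP[y0 y1].
have yb : 0 <= y <= 1 by rewrite !ltW.
transitivity (\int[P]_w ((x * y ^+ born_at m w) *
    ((imm m w)%:R * y ^+ (imm m w).-1))%:E)%E.
  apply: eq_integral => w _; congr EFin.
  rewrite (eq_big_nat _ _ (F2 := fun=> x * y ^+ (pop_at w m).-1)); last first.
    by move=> a /andP[_ am]; exact: prod_weight0.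
  rewrite sumr_const_nat /pop_at /pop -/(born_at m w) addKn.
  case: (imm m w) => [|k]; first by rewrite mulr0n mul0r mulr0.
  by rewrite addnS/= exprD -mulr_natl; ring.
rewrite (immigration_step imm_law indep (u := fun k => k%:R * y ^+ k.-1)
  (Y := fun w => x * y ^+ born_at m w)); last 3 first.
- by move=> w w' /Nproc_history ->.
- by move=> w; rewrite !mulr_ge0// exprn_ge0// ltW.
- by move=> k; rewrite mulr_ge0// exprn_ge0// ltW.
rewrite (integral_pgf_derive1 (measurable_RV_pre I) y01).
under eq_integral do rewrite EFinM.
rewrite ge0_integralZl//; last 2 first.
- move=> _ B _; rewrite setTI.
  exact: (measurable_Nproc imm xi m ((fun N => (y ^+ N)%:E) @^-1` B)).
- by move=> w _; rewrite lee_fin exprn_ge0// ltW.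
have [-> _] := pgf_bounds P (measurable_Nproc imm xi m) yb.
by rewrite -!EFinM -/g; congr EFin; ring.
Qed.

End FounderGeneratingFunctions.

Section FamilySize.
Context {d : measure_display} {Omega : measurableType d} {R : realType}.
Variables (P : probability Omega R) (M I : {RV P >-> nat}).
Variables (imm : nat -> {RV P >-> nat}) (xi : nat -> nat -> {RV P >-> nat}).
Hypothesis imm_law : forall n, distribution P (imm n) = distribution P I.
Hypothesis xi_law : forall n j, distribution P (xi n j) = distribution P M.
Hypothesis indep : mutually_independent (gwi_family imm xi).

Let f : R -> R := pgf P M.
Let g : R -> R := pgf P I.
Local Notation history := (history imm xi).
Local Notation historyI := (historyI imm xi).
Local Notation pop_at := (pop_at imm xi).
Local Notation weight_at := (weight_at imm xi).
Local Notation descendants_at := (descendants_at imm xi).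
Local Notation born_at n w := (Nproc imm xi n w).

Lemma descendants_history n b a w w' : history n w = history n w' ->
  descendants_at w n b a = descendants_at w' n b a.
Proof.
move=> h; rewrite /descendants_at /descendants -/(born_at n w) -/(born_at n w').
rewrite (Nproc_history h); apply: eq_count => c.
by move/history_eqP in h; rewrite (ancestor_congr h).
Qed.

Lemma descendants_le n b a w : (descendants_at w n b a <= born_at n w)%N.
Proof.
by rewrite (leq_trans (count_size _ _))// size_iota.
Qed.

(** Fix [y = z] in the generating function of [lineage_gf]: as a function of
    [x] it is a power series with nonnegative coefficients, and a multiple of
    [iter b.+1 f].  Its [i]-th derivative at [x = z] is the expectation sought,
    because [z^(Z-i) z^(N-Z) = z^(N-i)].  The map [c] describes the founders. *)
Lemma lineage_derivative m b (lo hi : Omega -> nat) (c : R -> R) i z :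
  (forall w w', historyI m w = historyI m w' -> lo w = lo w' /\ hi w = hi w') ->
  (forall x y, 0 <= x <= 1 -> y \in `]0, 1[ ->
    (\int[P]_w (\sum_(lo w <= a < hi w)
       \prod_(0 <= j < pop_at w m) weight_at w x y m 0 a j)%:E = (x * c y)%:E)%E) ->
  pgf P M 0 = 0 -> z \in `]0, 1[ ->
  (\int[P]_w (\sum_(lo w <= a < hi w)
      (descendants_at w (m + b).+1 b.+1 a ^_ i)%:R *
      z ^+ (born_at (m + b).+1 w - i))%:E =
   (derive1n i (iter b.+1 f) z *
    (c (iter b.+1 f z) * \prod_(1 <= s < b.+1) g (iter s f z)))%:E)%E.
Proof.
move=> lohi Kc fz0 z01; have /andP[z0 z1] : 0 < z < 1 by rewrite in_itv/= in z01.
have zb : 0 <= z <= 1 by rewrite !ltW.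
set n := (m + b).+1; set l := b.+1.
have flz : iter l f z \in `]0, 1[.
  elim: l => //= l ih; apply: pgf_open => //; exact: measurable_RV_pre.
have lohi' w w' : history n w = history n w' -> lo w = lo w' /\ hi w = hi w'.
  by move=> h; apply: lohi; apply: historyI_lt h; rewrite ltnS leq_addr.
pose C := c (iter l f z) * \prod_(1 <= s < l) g (iter s f z).
pose Z w a := descendants_at w n l a.
pose q k w : R := (\sum_(lo w <= a < hi w) (Z w a == k)%:R) * z ^+ (born_at n w - k).
have q0 k w : 0 <= q k w.
  by rewrite mulr_ge0// ?exprn_ge0 ?(ltW z0)// sumr_ge0.
have mq (s : R) k : measurable_fun setT (fun w => (s * q k w)%:E).
  apply: (measurable_fun_fibers (measurable_history imm xi n)) => w w' h.
  rewrite /q (Nproc_history h); have [-> ->] := lohi' _ _ h.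
  by under eq_bigr do rewrite /Z (descendants_history _ _ h).
(* Grouping the founders by their number of descendants separates the values of
   [u] from coefficients that do not depend on [u]; it is used for [u k = x^k] and
   for its [i]-th derivative at [z]. *)
have series_Z (u : nat -> R) : (forall k, 0 <= u k) ->
    (\int[P]_w (\sum_(lo w <= a < hi w) u (Z w a) * z ^+ (born_at n w - Z w a))%:E =
     \sum_(0 <= k <oo) (u k)%:E * \int[P]_w (q k w)%:E)%E.
  move=> u0.
  transitivity (\int[P]_w (\sum_(0 <= k <oo) (u k * q k w)%:E))%E.
    apply: eq_integral => w _.
    transitivity (\sum_(0 <= k <oo) \sum_(a <- index_iota (lo w) (hi w))
       ((u k * z ^+ (born_at n w - k)) * (Z w a == k)%:R)%:E)%E; last first.
      apply: eq_eseriesr => k _; rewrite sumEFin -mulr_sumr /q; congr EFin.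
      by rewrite -mulrA; congr (_ * _); rewrite mulrC.
    rewrite nneseries_sum; last first.
      by move=> a k _; rewrite lee_fin !mulr_ge0// exprn_ge0// ltW.
    rewrite -sumEFin; apply: eq_bigr => a _.
    by rewrite (nneseries_single (fun k => u k * z ^+ (born_at n w - k))).
  rewrite integral_nneseries//; last by move=> k w _; rewrite lee_fin mulr_ge0.
  apply: eq_eseriesr => k _; under eq_integral do rewrite EFinM.
  rewrite ge0_integralZl ?lee_fin//.
  - by have := mq 1 k; under eq_fun do rewrite mul1r.
  - by move=> w _; rewrite lee_fin.
have qgf x : x \in `]0, 1[ ->
    (\sum_(0 <= k <oo) (x ^+ k)%:E * \int[P]_w (q k w)%:E = (iter l f x * C)%:E)%E.
  rewrite in_itv/= => /andP[x0 x1].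
  have xb : 0 <= x <= 1 by rewrite !ltW.
  rewrite -series_Z; last by move=> k; rewrite exprn_ge0// ltW.
  rewrite (_ : (iter l f x * C)%:E = ((iter l f x * c (iter l f z))%:E *
     (\prod_(1 <= s < l) g (iter s f z))%:E)%E); last first.
    by rewrite -EFinM mulrA.
  rewrite -Kc//; last exact: iter_pgf_bounds.
  rewrite -(lineage_gf imm_law xi_law indep b lohi xb zb).
  apply: eq_integral => w _; congr EFin; apply: eq_bigr => a _.
  exact/esym/prod_weight_descendants.
(* one convergent value of the series bounds every coefficient *)
have half01 : (2^-1 : R) \in `]0, 1[.
  by rewrite in_itv/= invr_gt0 ltr0n invf_lt1 ?ltr0n// ltr1n.
have iq0 k : (0 <= \int[P]_w (q k w)%:E)%E.
  by apply: integral_ge0 => w _; rewrite lee_fin.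
have qfin k : (\int[P]_w (q k w)%:E)%E \is a fin_num.
  rewrite ge0_fin_numE//.
  have : ((2^-1 ^+ k)%:E * \int[P]_w (q k w)%:E < +oo)%E.
    apply: le_lt_trans (ltry (iter l f 2^-1 * C)); rewrite -qgf//.
    have t0 j : (0 <= (2^-1 ^+ j)%:E * \int[P]_w (q j w)%:E)%E.
      by rewrite mule_ge0// lee_fin exprn_ge0// invr_ge0.
    apply: le_trans (nneseries_lim_ge k.+1 _) => //.
    rewrite big_nat_recr//= leeDr//; apply: sume_ge0 => j _; exact: t0.
  rewrite !ltey; apply: contra => /eqP ->.
  by rewrite gt0_muley// lte_fin exprn_gt0// invr_gt0.
pose e k := fine (\int[P]_w (q k w)%:E)%E.
have eE k : (\int[P]_w (q k w)%:E)%E = (e k)%:E by rewrite fineK.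
have e0 k : 0 <= e k by rewrite fine_ge0.
have egf : {in `]0, 1[, forall x, (\sum_(0 <= k <oo) (e k * x ^+ k)%:E
    = (iter l f x * C)%:E)%E}.
  by move=> x x01; rewrite -qgf//; apply: eq_eseriesr => k _; rewrite eE -EFinM mulrC.
have C0 : 0 <= C.
  have := egf _ half01.
  have pos : 0 < iter l f 2^-1.
    suff : iter l f 2^-1 \in `]0, 1[ by rewrite in_itv/= => /andP[].
    by elim: (l) => //= l' ih; apply: pgf_open => //; exact: measurable_RV_pre.
  move=> h; have : (0 <= (iter l f 2^-1 * C)%:E)%E.
    by rewrite -h; apply: nneseries_ge0 => k _ _; rewrite lee_fin mulr_ge0// exprn_ge0// invr_ge0.
  by rewrite lee_fin pmulr_rge0.
rewrite -/C -(nneg_pseries_derive1n_scaled i C0 e0 egf z01).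
rewrite (eq_integral (fun w => (\sum_(lo w <= a < hi w)
    ((Z w a ^_ i)%:R * z ^+ (Z w a - i)) * z ^+ (born_at n w - Z w a))%:E)); last first.
  move=> w _; congr EFin; apply: eq_bigr => a _; rewrite -/(Z w a) -mulrA.
  have [Zi|iZ] := ltnP (Z w a) i; first by rewrite ffact_small// !mul0r.
  rewrite -exprD; congr (_ * _ ^+ _).
  by rewrite addnC addnBA// subnK// descendants_le.
rewrite (series_Z (fun k => (k ^_ i)%:R * z ^+ (k - i))); last first.
  by move=> k; rewrite mulr_ge0// exprn_ge0// ltW.
apply: eq_eseriesr => k _; rewrite eE -EFinM; congr EFin.
by rewrite mulrAC.
Qed.

End FamilySize.

(** * Sampling from the tree *)

Lemma sigma_algebra_setI (T : Type) (G : set (set T)) (A B : set T) :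
  <<s G >> A -> <<s G >> B -> <<s G >> (A `&` B).
Proof.
move=> sA sB.
have sC (C : set T) : <<s G >> C -> <<s G >> (~` C).
  by move=> sGC; rewrite -setTD; exact: sigma_algebraCD.
rewrite -[A `&` B]setCK setCI -bigcup2E; apply: (sC).
apply: sigma_algebra_bigcup; case=> [|[|k]] /=; [exact: sC|exact: sC|].
exact: sigma_algebra0.
Qed.

Section Sampling.
Context {d : measure_display} {Omega : measurableType d} {R : realType}.
Variables (P : probability Omega R).
Variables (imm : nat -> {RV P >-> nat}) (xi : nat -> nat -> {RV P >-> nat}).
Variables (n i : nat) (S : Omega -> i.-tuple nat).
Hypothesis S_unif : uniform_sample imm xi n S.

Local Notation history := (history imm xi).
Local Notation born_at n w := (Nproc imm xi n w).

Definition coalesced_at m w (s : seq nat) : bool :=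
  coalesced_since (fun k => imm k w) (fun k j => xi k j w) m n s.

Definition coalesced_tuples m w : seq (i.-tuple 'I_(born_at n w)) :=
  enum [set s : i.-tuple 'I_(born_at n w) | uniq s && coalesced_at m w (map val s)]%SET.

Definition coalesced_count m w : nat := size (coalesced_tuples m w).

(** The law of the sample is only prescribed jointly with events of the tree. *)
Lemma tree_events_history k w0 :
  tree_events imm xi [set w | history k w = history k w0].
Proof.
elim: k => [|k ih].
  rewrite (_ : [set _ | _] = setT `\` set0).
    by apply: sigma_algebraCD; exact: sigma_algebra0.
  by rewrite setD0; apply/seteqP; split.
rewrite (_ : [set _ | _] = [set w | history k w = history k w0] `&`
   [set w | litters_at imm xi w k = litters_at imm xi w0 k]).
  apply: sigma_algebra_setI => //; apply: sub_sigma_algebra.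
  by exists k, (litters_at imm xi w0 k).
apply/seteqP; split=> w /=.
  move=> /history_eqP h; split; last exact: h.
  by apply/history_eqP => j jk; apply: h; exact: ltnW.
move=> [/history_eqP h hk]; apply/history_eqP => j.
by rewrite ltnS leq_eqVlt => /predU1P[->//|/h].
Qed.

Lemma coalesced_at_history m w w' s : history n.+1 w = history n.+1 w' ->
  coalesced_at m w s = coalesced_at m w' s.
Proof. by move=> /history_eqP h; exact: coalesced_since_congr. Qed.

Lemma measurable_history_sample (t : seq (seq nat) * i.-tuple nat) :
  measurable [set w | (history n.+1 w, S w) = t].
Proof.
case: t => h s; rewrite (_ : [set _ | _] =
    [set w | history n.+1 w = h] `&` S @^-1` [set s]).
  by apply: measurableI; [exact: measurable_history|exact: S_unif.1].
by apply/seteqP; split=> w /= [-> ->].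
Qed.

Lemma measurable_coalescence m : measurable [set w | coalesced_at m w (S w)].
Proof.
apply: (measurable_set_fibers measurable_history_sample) => w w' /=.
move=> ww'; have /= -> := congr1 snd ww'; have /= h := congr1 fst ww'.
by rewrite (coalesced_at_history _ _ h).
Qed.

(** The type of the tuples depends on [w], so their number is compared instead. *)
Lemma card_coalesced_history m w w' : history n.+1 w = history n.+1 w' ->
  coalesced_count m w = coalesced_count m w'.
Proof.
move=> h; rewrite /coalesced_count /coalesced_tuples -!cardE.
have bE := Nproc_history (history_le (leqnSn n) h).
have : forall N, N = born_at n w' ->
  #|[set s : i.-tuple 'I_N | uniq s && coalesced_at m w (map val s)]%SET| =
  #|[set s : i.-tuple 'I_(born_at n w') | uniq s && coalesced_at m w' (map val s)]%SET|.
  move=> _ ->; apply: eq_card => s; rewrite !inE; congr (_ && _).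
  exact: coalesced_at_history.
exact.
Qed.

Lemma mem_coalesced_tuples m w (s : i.-tuple nat) :
  (s \in [seq map_tuple val t | t <- coalesced_tuples m w]) =
  [&& uniq s, all (fun c => c < born_at n w)%N s & coalesced_at m w s].
Proof.
apply/mapP/and3P => [[t]|[us sN sc]].
  rewrite mem_enum inE => /andP[ut tc] ->; split => //=.
    by rewrite map_inj_uniq//; exact: val_inj.
  by apply/allP => _ /mapP[c _ ->]; exact: ltn_ord.
have tP (j : 'I_i) : (tnth s j < born_at n w)%N by apply: (allP sN); exact: mem_tnth.
pose t := [tuple Ordinal (tP j) | j < i].
have st : s = map_tuple val t.
  by apply: eq_from_tnth => j; rewrite tnth_map tnth_mktuple.
exists t => //; rewrite mem_enum inE.
have stv : map val t = s by exact: esym (congr1 val st).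
by rewrite stv sc andbT -(map_inj_uniq val_inj) stv.
Qed.

(** On a fiber of the history the sample takes each injective tuple of
    individuals with the same probability and no other value, so that the
    probability is proportional to the number of favourable tuples.  If
    fewer than [i] individuals are born, no value is possible and the fiber is null. *)
Lemma probability_coalesced m :
  (P [set w | coalesced_at m w (S w)] =
   \int[P]_w ((coalesced_count m w)%:R * ((born_at n w ^_ i)%:R)^-1)%:E)%E.
Proof.
set E := [set w | _]; have mE : measurable E by exact: measurable_coalescence.
have mH := measurable_history imm xi n.+1.
have indicE (A B : set Omega) : measurable A -> measurable B ->
    (\int[P]_(w in A) (\1_B w)%:E = P (B `&` A))%E.
  by move=> mA mB; exact: integral_indic.
rewrite -[E]setIT -indicE//.
apply: (eq_ge0_integral_fibers mH).
- exact/measurable_EFinP/measurable_indic.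
- apply: (measurable_fun_fibers mH) => w w' h.
  by rewrite (card_coalesced_history m h) (Nproc_history (history_le (leqnSn n) h)).
- by move=> w; rewrite lee_fin.
- by move=> w; rewrite lee_fin mulr_ge0// invr_ge0.
move=> w0; set D := [set w | _].
have mD : measurable D by exact: mH.
have DN w : D w -> born_at n w = born_at n w0.
  by move=> h; exact: Nproc_history (history_le (leqnSn n) h).
have mS s : measurable [set w | S w = s] by exact: S_unif.1.
pose r : R := (born_at n w0 ^_ i)%:R^-1 * fine (P D).
have PDE : P D = (fine (P D))%:E by rewrite fineK// fin_num_measure.
pose G := [seq map_tuple val t | t <- coalesced_tuples m w0].
have uG : uniq G.
  rewrite map_inj_uniq ?enum_uniq// => t t' /(congr1 val)/= tt'.
  by apply/val_inj/(inj_map val_inj).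
have cellE (s : i.-tuple nat) :
    P (D `&` [set w | S w = s]) = (r * (uniq s && all (fun c => c < born_at n w0)%N s)%:R)%:E.
  have := S_unif.2 _ s (tree_events_history n.+1 w0); rewrite -/D => ->.
  rewrite (eq_integral (fun=> ((born_at n w0 ^_ i)%:R^-1 *
     (uniq s && all (fun c => c < born_at n w0)%N s)%:R)%:E)); last first.
    move=> w; rewrite inE => /DN ->; congr EFin.
    by case: ifP => _; rewrite ?mulr1// mulr0.
  rewrite integral_cst// [X in (_ * X)%E]PDE -EFinM; congr EFin.
  by rewrite /r mulrAC.
rewrite indicE// [RHS](eq_integral (fun=> ((coalesced_count m w0)%:R *
   ((born_at n w0 ^_ i)%:R)^-1)%:E)); last first.
  by move=> w; rewrite inE => /[dup] /DN -> /(card_coalesced_history m) ->.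
rewrite integral_cst// [X in (_ = _ * X)%E]PDE -EFinM -mulrA -/r.
have mB : measurable (E `&` D) by exact: measurableI.
rewrite -[E `&` D]setIT -indicE// (ge0_integral_fibers mS); last 2 first.
- exact/measurable_EFinP/measurable_indic.
- by move=> w; rewrite lee_fin.
transitivity (\sum_(0 <= j <oo) \sum_(s <- G) (r * (choice.pickle s == j)%:R)%:E)%E.
  apply: eq_eseriesr => j _; rewrite indicE//; last exact: measurable_fiber.
  case sj : (@choice.pickle_inv (i.-tuple nat) j) => [s|]; last first.
    have no (s : i.-tuple nat) : (choice.pickle s == j) = false.
      by apply/negP => /eqP js; move: sj; rewrite -js choice.pickleK_inv.
    rewrite big1; last by move=> s _; rewrite no mulr0.
    rewrite (_ : _ `&` _ = set0) ?measure0//.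
    by apply/seteqP; split=> // w [_ /eqP]; rewrite no.
  have {}sj : choice.pickle s = j.
    by have := @choice.pickle_invK (i.-tuple nat) j; rewrite sj.
  rewrite sumEFin -mulr_sumr.
  have -> : \sum_(s' <- G) (choice.pickle s' == j)%:R = (s \in G)%:R :> R.
    rewrite -(count_uniq_mem _ uG) -sum1_count natr_sum [RHS]big_mkcond.
    apply: eq_bigr => s' _; rewrite -sj (inj_eq (pcan_inj choice.pickleK))/=.
    by case: eqP.
  rewrite /G mem_coalesced_tuples.
  have -> : E `&` D `&` fiber S j =
      if coalesced_at m w0 s then D `&` [set w | S w = s] else set0.
    have SE w : fiber S j w <-> S w = s.
      split; last by rewrite /fiber /= => ->.
      by rewrite /fiber /= -sj => /(pcan_inj choice.pickleK).
    have EE w : D w -> S w = s -> E w = coalesced_at m w0 s :> Prop.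
      by move=> Dw Sw; rewrite /E /= Sw (coalesced_at_history m s Dw).
    case: ifPn => cs; apply/seteqP; split=> w //=.
    + by move=> [[_ Dw] /SE].
    + by move=> [Dw Sw]; split; [split=> //; rewrite EE|exact/SE].
    + by move=> [[Ew Dw] /SE Sw]; move: Ew; rewrite EE// (negPf cs).
  case: ifP => cs; first by rewrite andbT; exact: cellE.
  by rewrite !andbF mulr0 measure0.
rewrite nneseries_sum; last first.
  by move=> s j _; rewrite lee_fin !mulr_ge0// ?invr_ge0// fine_ge0.
under eq_bigr do rewrite (nneseries_single (fun=> r)).
by rewrite sumEFin big_const_seq count_predT iter_addr_0 size_map mulr_natl.
Qed.

End Sampling.

Section FamilySampling.
Context {d : measure_display} {Omega : measurableType d} {R : realType}.
Variables (P : probability Omega R) (M I : {RV P >-> nat}).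
Variables (imm : nat -> {RV P >-> nat}) (xi : nat -> nat -> {RV P >-> nat}).
Hypothesis imm_law : forall n, distribution P (imm n) = distribution P I.
Hypothesis xi_law : forall n j, distribution P (xi n j) = distribution P M.
Hypothesis indep : mutually_independent (gwi_family imm xi).
Hypothesis M_pos : pgf P M 0 = 0.
Variables (n i : nat).
Hypothesis i_gt0 : (0 < i)%N.

Let f : R -> R := pgf P M.
Let g : R -> R := pgf P I.
Local Notation history := (history imm xi).
Local Notation historyI := (historyI imm xi).
Local Notation pop_at := (pop_at imm xi).
Local Notation weight_at := (weight_at imm xi).
Local Notation descendants_at := (descendants_at imm xi).
Local Notation born_at n w := (Nproc imm xi n w).

(** The probability, given the tree, that the whole sample descends from one of
    the individuals [lo w, ..., hi w - 1] of generation [m]. *)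
Definition sampled_family (m : nat) (lo hi : Omega -> nat) (w : Omega) : R :=
  (\sum_(lo w <= a < hi w) (descendants_at w n (n - m) a ^_ i)%:R) *
  (born_at n w ^_ i)%:R^-1.

Lemma sampled_family_ge0 m lo hi w : 0 <= sampled_family m lo hi w.
Proof. by rewrite mulr_ge0 ?invr_ge0// sumr_ge0. Qed.

Lemma sampled_family_history N m (lo hi : Omega -> nat) : (n <= N)%N -> (m < N)%N ->
  (forall w w', historyI m w = historyI m w' -> lo w = lo w' /\ hi w = hi w') ->
  forall w w', history N w = history N w' ->
  sampled_family m lo hi w = sampled_family m lo hi w'.
Proof.
move=> nN mN lohi w w' h; have hn := history_le nN h.
rewrite /sampled_family (Nproc_history hn).
have [-> ->] := lohi _ _ (historyI_lt mN h).
by under eq_bigr do rewrite (descendants_history _ _ hn).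
Qed.

(** The expectation of a mixture of powers [z^(N-i)] is given by
    [lineage_derivative].  When fewer than [i] individuals are born in generation
    [n], the Beta integral is not available but both sides vanish, as no family
    has [i] members.  The values at [z = 0] and [z = 1] do not matter for the
    integral, and nothing is known about the derivatives there. *)
Lemma expectation_sampled_family m (lo hi : Omega -> nat) (c : R -> R) : (m < n)%N ->
  (forall w w', historyI m w = historyI m w' -> lo w = lo w' /\ hi w = hi w') ->
  (forall x y, 0 <= x <= 1 -> y \in `]0, 1[ ->
    (\int[P]_w (\sum_(lo w <= a < hi w)
       \prod_(0 <= j < pop_at w m) weight_at w x y m 0 a j)%:E = (x * c y)%:E)%E) ->
  (\int[P]_w (sampled_family m lo hi w)%:E =
   ((Gamma (i%:R : R))^-1)%:E * \int[lebesgue_measure]_(z in `[0%R, 1%R])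
     ((1 - z) ^+ (i - 1) * derive1n i (fun z => iter (n - m) f z) z *
      (c (iter (n - m) f z) * \prod_(1 <= s < n - m) g (iter s f z)))%:E)%E.
Proof.
move=> mn lohi Kc.
have [b nE] : exists b, n = (m + b).+1.
  by exists (n - m).-1; rewrite -addnS prednK ?subn_gt0// subnKC// ltnW.
have nmE : (n - m)%N = b.+1 by rewrite nE -addnS addKn.
pose H w z : \bar R := ((1 - z) ^+ (i - 1) *
  \sum_(lo w <= a < hi w) (descendants_at w n b.+1 a ^_ i)%:R *
     z ^+ (born_at n w - i))%:E.
have HE w w' z : history n w = history n w' -> H w z = H w' z.
  move=> h; rewrite /H (Nproc_history h).
  have [-> ->] := lohi _ _ (historyI_lt mn h).
  by under eq_bigr do rewrite (descendants_history _ _ h).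
have mH w : measurable_fun (`]0%R, 1%R[%classic : set R) (H w).
  apply/measurable_EFinP/measurable_funTS; apply: measurable_funM.
    by apply: measurable_funX; exact: measurable_funB.
  apply: measurable_sum => a; apply: measurable_funM => //.
have H0 w z : `]0%R, 1%R[%classic z -> (0 <= H w z)%E.
  rewrite /= in_itv/= => /andP[z0 z1]; rewrite lee_fin mulr_ge0//.
    by rewrite exprn_ge0// subr_ge0 ltW.
  by rewrite sumr_ge0// => a _; rewrite mulr_ge0// exprn_ge0// ltW.
have mhist := measurable_history imm xi n.
have Gam0 : 0 <= (Gamma (i%:R : R))^-1.
  by case: i i_gt0 => // i' _; rewrite Gamma_fact invr_ge0.
transitivity (\int[P]_w (((Gamma (i%:R : R))^-1)%:E *
    \int[lebesgue_measure]_(z in `]0%R, 1%R[) H w z))%E.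
  apply: eq_integral => w _.
  have [Ni|iN] := ltnP (born_at n w) i.
    have Z0 a : (descendants_at w n b.+1 a ^_ i)%:R = 0 :> R.
      by rewrite ffact_small//; apply: leq_ltn_trans Ni; exact: descendants_le.
    rewrite /sampled_family nmE big1 ?mul0r; last by move=> a _; exact: Z0.
    rewrite integral0_eq ?mule0// => z _; rewrite /H big1 ?mulr0// => a _.
    by rewrite Z0 mul0r.
  rewrite /sampled_family nmE EFinM ffactV_beta ?i_gt0// muleCA; congr (_ * _)%E.
  rewrite -ge0_integralZl ?lee_fin ?sumr_ge0//.
  - apply: eq_integral => z _; rewrite -EFinM; congr EFin.
    by rewrite -mulr_suml; ring.
  - apply/measurable_EFinP/measurable_funTS; apply: measurable_funM.
      by apply: measurable_funX; exact: measurable_funB.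
    exact: exprn_measurable.
  - move=> z; rewrite /= in_itv/= => /andP[z0 z1]; rewrite lee_fin.
    by apply: mulr_ge0; apply: exprn_ge0; rewrite ?subr_ge0 ltW.
rewrite ge0_integralZl ?lee_fin//; last 2 first.
- apply: (measurable_fun_fibers mhist) => w w' h.
  by apply: eq_integral => z _; exact: HE.
- by move=> w _; apply: integral_ge0 => z; exact: H0.
congr (_ * _)%E.
rewrite (fubini_fibers P lebesgue_measure mhist (measurable_itv _) HE mH H0)//.
have EH : {in `]0%R, 1%R[%classic, (fun z => \int[P]_w H w z)%E =1
   (fun z => ((1 - z) ^+ (i - 1) * derive1n i (fun z => iter (n - m) f z) z *
      (c (iter (n - m) f z) * \prod_(1 <= s < n - m) g (iter s f z)))%:E)}.
  move=> z; rewrite inE /= => z01; have := z01; rewrite in_itv/= => /andP[z0 z1].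
  have := lineage_derivative imm_law xi_law indep b i lohi Kc M_pos z01.
  rewrite -nE => Ez; rewrite nmE -mulrA EFinM -[X in (_ * X)%E]Ez.
  rewrite -ge0_integralZl ?lee_fin ?exprn_ge0 ?subr_ge0 ?(ltW z1)//.
  - apply: (measurable_fun_fibers mhist) => w w' h.
    rewrite (Nproc_history h); have [-> ->] := lohi _ _ (historyI_lt mn h).
    by under eq_bigr do rewrite (descendants_history _ _ h).
  - by move=> w _; rewrite lee_fin sumr_ge0// => a _; rewrite mulr_ge0// exprn_ge0// ltW.
rewrite [RHS]integral_itv_bndoo; first exact: eq_integral.
apply: eq_measurable_fun EH _.
exact: (measurable_integral_fibers P mhist HE mH H0).
Qed.

End FamilySampling.

(** * The distribution of the coalescence time *)

Section FounderFamilies.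
Context {d : measure_display} {Omega : measurableType d} {R : realType}.
Variables (P : probability Omega R).
Variables (imm : nat -> {RV P >-> nat}) (xi : nat -> nat -> {RV P >-> nat}).
Variables (n i : nat) (S : Omega -> i.-tuple nat).
Hypothesis S_unif : uniform_sample imm xi n S.
Hypothesis i_gt0 : (0 < i)%N.

Lemma probability_coalesced_families m : (m < n)%N ->
  (P [set w | coalesced_at imm xi n m w (S w)] =
   \int[P]_w (sampled_family imm xi n i m (fun=> 0%N) (Nproc imm xi m) w)%:E +
   \sum_(m <= k < n) \int[P]_w
     (sampled_family imm xi n i k (Nproc imm xi k) (pop_at imm xi ^~ k) w)%:E)%E.
Proof.
move=> mn; rewrite (probability_coalesced S_unif).
have F0 k lo hi w : (0 <= (sampled_family imm xi n i k lo hi w)%:E)%E.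
  by rewrite lee_fin sampled_family_ge0.
have mF k lo hi :
    (forall w w', historyI imm xi k w = historyI imm xi k w' -> lo w = lo w' /\ hi w = hi w') ->
    measurable_fun setT (fun w => (sampled_family imm xi n i k lo hi w)%:E).
  move=> lohi.
  apply: (measurable_fun_fibers (measurable_history imm xi (maxn n k.+1))) => w w' h.
  by rewrite (sampled_family_history i (leq_maxl _ _) (leq_maxr n k.+1) lohi h).
have lohi0 k w w' : historyI imm xi k w = historyI imm xi k w' ->
    0%N = 0%N /\ Nproc imm xi k w = Nproc imm xi k w'.
  by move=> /(congr1 fst) h; split=> //; exact: Nproc_history h.
have lohi1 k w w' : historyI imm xi k w = historyI imm xi k w' ->
    Nproc imm xi k w = Nproc imm xi k w' /\ pop_at imm xi w k = pop_at imm xi w' k.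
  by move=> h; split; [exact: (Nproc_history (congr1 fst h))|exact: pop_historyI].
rewrite -ge0_integral_sum//; last by move=> k; apply: mF; exact: lohi1.
rewrite -ge0_integralD//; last 3 first.
- by apply: mF; exact: lohi0.
- by move=> w _; apply: sume_ge0 => k _; exact: F0.
- by apply: emeasurable_sum => k; apply: mF; exact: lohi1.
apply: eq_integral => w _; rewrite sumEFin -EFinD; congr EFin.
rewrite /coalesced_count /coalesced_tuples -cardE card_coalesced_tuples//.
rewrite natrD mulrDl natr_sum; congr (_ + _).
rewrite natr_sum mulr_suml; apply: eq_bigr => k _.
by rewrite /sampled_family natr_sum.
Qed.

End FounderFamilies.

Lemma prod_skip_nat (R : comNzRingType) (F : nat -> R) n k : (1 <= k <= n)%N ->
  (\prod_(1 <= s < (n - k).+1) F (s + k)%N) * (\prod_(1 <= s < k) F s) =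
  \prod_(1 <= s < n.+1 | s != k) F s.
Proof.
move=> /andP[k1 kn]; rewrite mulrC.
rewrite [RHS](big_cat_nat (n := k)) ?(leqW kn)//=; congr (_ * _).
  rewrite big_nat_cond [RHS]big_nat_cond; apply: eq_bigl => s.
  by case: (ltnP s k) => sk; rewrite ?andbF// (ltn_eqF sk).
rewrite [RHS]big_ltn_cond ?ltnS// eqxx /= -[k.+1]addn1 addnC big_addn.
rewrite -subSn// big_nat_cond [RHS]big_nat_cond; apply: eq_bigl => s.
by rewrite -[X in _ != X]add0n eqn_add2r; case: s.
Qed.

Theorem theorem1 (R : realType) (d : measure_display) (Omega : measurableType d)
  (P : probability Omega R)
  (M I : {RV P >-> nat})
  (imm : nat -> {RV P >-> nat}) (xi : nat -> nat -> {RV P >-> nat})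
  (imm_law : forall n, distribution P (imm n) = distribution P I)
  (xi_law : forall n j, distribution P (xi n j) = distribution P M)
  (indep : mutually_independent (gwi_family imm xi))
  (f0 : pgf P M 0 = 0) (g0 : pgf P I 0 = 0)
  (i n m : nat) (i_ge2 : (2 <= i)%N) (i_le_n : (i <= n)%N) (m_lt_n : (m < n)%N)
  (S : Omega -> i.-tuple nat) (S_unif : uniform_sample imm xi n S) :
  let f : R -> R := pgf P M in
  let g : R -> R := pgf P I in
  let f_ (l : nat) : R -> R := fun z => iter l f z in
  let phi (k : nat) : R -> R := pgf P (Nproc imm xi k) in
  let X : Omega -> \bar R := coalescence imm xi n S in
  (P [set w | X w = +oo] =
     1 - \sum_(1 <= l < n.+1)
           ((Gamma (i%:R : R))^-1)%R%:E *
           \int[lebesgue_measure]_(z in `[0%R, 1%R])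
             ((1 - z) ^+ (i - 1)%N * derive1n i (f_ l) z * derive1 g (f_ l z) *
              \prod_(1 <= s < n.+1 | s != l) g (f_ s z))%R%:E)%E
  /\
  (P [set w | (m%:R)%R%:E <= X w < +oo] =
     ((Gamma (i%:R : R))^-1)%R%:E *
     \int[lebesgue_measure]_(z in `[0%R, 1%R])
       ((1 - z) ^+ (i - 1)%N * derive1n i (f_ (n - m)%N) z * derive1 (phi m) (f_ (n - m)%N z) *
        \prod_(1 <= l < (n - m)%N.+1) g (f_ l z))%R%:E
     + \sum_(1 <= k < (n - m)%N.+1)
         ((Gamma (i%:R : R))^-1)%R%:E *
         \int[lebesgue_measure]_(z in `[0%R, 1%R])
           ((1 - z) ^+ (i - 1)%N * derive1n i (f_ k) z * derive1 g (f_ k z) *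
            \prod_(1 <= l < n.+1 | l != k) g (f_ l z))%R%:E)%E.
Proof.
move=> f g f_ phi X.
have i0 : (0 < i)%N by exact: ltn_trans i_ge2.
have m0 : (0 < n)%N by exact: leq_ltn_trans m_lt_n.
pose E m := [set w | coalesced_at imm xi n m w (S w)].
have XE k : [set w | (k%:R%R%:E <= X w < +oo)%E] = E k.
  by apply/seteqP; split=> w; rewrite /E /= /coalesced_at -(@coalescence_timeP R).
have fz y : y \in `]0, 1[ -> 0 <= y <= 1.
  by rewrite in_itv/= => /andP[y0 y1]; rewrite !ltW.
have main k : (k < n)%N -> (P (E k) =
     ((Gamma (i%:R : R))^-1)%R%:E *
     \int[lebesgue_measure]_(z in `[0%R, 1%R])
       ((1 - z) ^+ (i - 1)%N * derive1n i (f_ (n - k)%N) z * derive1 (phi k) (f_ (n - k)%N z) *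
        \prod_(1 <= l < (n - k)%N.+1) g (f_ l z))%R%:E
     + \sum_(1 <= l < (n - k)%N.+1)
         ((Gamma (i%:R : R))^-1)%R%:E *
         \int[lebesgue_measure]_(z in `[0%R, 1%R])
           ((1 - z) ^+ (i - 1)%N * derive1n i (f_ l) z * derive1 g (f_ l z) *
            \prod_(1 <= s < n.+1 | s != l) g (f_ s z))%R%:E)%E.
  move=> kn; rewrite (probability_coalesced_families S_unif i0 kn); congr (_ + _)%E.
    rewrite (@expectation_sampled_family _ _ _ P M I imm xi imm_law xi_law indep f0 n i i0
      k (fun=> 0%N) (Nproc imm xi k) (fun y => derive1 (phi k) y * g y) kn); last 2 first.
    - by move=> w w' /(congr1 fst) h; split=> //; exact: Nproc_history h.
    - by move=> x y; exact: (born_founders_gf imm_law indep).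
    congr (_ * _)%E; apply: eq_integral => z _; congr EFin.
    have nk1 : (1 <= n - k)%N by rewrite subn_gt0.
    by rewrite [in RHS]big_nat_recr//= /f_ /f /g; ring.
  (* in the statement the index counts generations back from [n] *)
  rewrite [RHS]big_add1/= -{1}[k]add0n big_addn big_nat_rev/=.
  apply: eq_big_nat => l /andP[_ lnk].
  have lE : (0 + (n - k) - l.+1 + k = n - l.+1)%N.
    by lia.
  have ln : (l.+1 <= n)%N by exact: leq_trans lnk (leq_subr _ _).
  rewrite lE (@expectation_sampled_family _ _ _ P M I imm xi imm_law xi_law indep f0 n i i0
      (n - l.+1) (Nproc imm xi (n - l.+1)) (pop_at imm xi ^~ (n - l.+1)%N)
      (fun y => derive1 g y * phi (n - l.+1)%N y)); last 3 first.
  - by rewrite ltn_subrL.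
  - by move=> w w' h; split; [exact: (Nproc_history (congr1 fst h))|exact: pop_historyI].
  - by move=> x y; exact: (immigrant_founders_gf imm_law indep).
  rewrite subKn//; congr (_ * _)%E; apply: eq_integral => z; rewrite inE/= in_itv/= => z01.
  have fl01 := iter_pgf_bounds M l.+1 z01.
  congr EFin; rewrite -(@prod_skip_nat _ (fun s => g (f_ s z)) n l.+1)//.
  rewrite /phi (pgf_Nproc imm_law xi_law indep _ fl01).
  under [X in _ * (_ * X * _) = _]eq_bigr do rewrite -iterD.
  by rewrite /f_ /f /g; ring.
have E0E : [set w | X w = +oo%E] = ~` E 0%N.
  rewrite -XE; apply/seteqP; split=> w /= => [->|]; first by rewrite ltxx andbF.
  rewrite /X /coalescence /coalescence_time; case: ifP => //= _.
  by rewrite lee_fin ler0n ltry.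
split; last by rewrite XE main.
rewrite E0E probability_setC; last exact: measurable_coalescence.
congr (_ - _)%E; rewrite main// subn0.
have -> : derive1 (phi 0%N) = cst 0.
  have -> : phi 0%N = cst 1.
    apply/funext => y; rewrite /phi /pgf unlock.
    under eq_integral do rewrite expr0.
    by rewrite integral_probability_cst.
  by apply/funext => y; rewrite derive1_cst.
rewrite [X in (_ * X + _)%E]integral0_eq ?mule0 ?add0e//.
by move=> z _; rewrite mulr0 mul0r.
Qed.
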